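(* Let $d\in\mathbb{N}$ with $d\geq 2$ and let $(e_{n})_{n\in\mathbb{N}}$ be a sequence of real numbers with $e_{n}\geq 1$. Then there exists a sequence $(c_{n})$ of positive real numbers satisfying $$|c_{n}-e_{n}|\leq \frac{2^{d+8}}{(\log n)^{1/d}}\quad\text{for all } n\geq 2,$$ such that the following holds. For each $n\in\mathbb{N}$ define $F_{n}\colon \binom{\mathbb{Z}^{d}}{n^{d}}\to(0,\infty)$ by $$F_{n}(S)=\min\{\operatorname{Lip}(f)\colon f\colon S\to\{1,\ldots,n\}^{d}\text{ surjective}\}.$$ Consider the probability space $\mathcal{G}_{(c_{n})}=\prod_{n=1}^{\infty}\binom{\{1,\ldots,\lfloor c_{n} n\rfloor\}^{d}}{n^{d}}$ equipped with the product of the uniform probability measures on its finite factors. Then a random sequence $(S_{n})\in\mathcal{G}_{(c_{n})}$ satisfies $$\mathbb{P}\left[\limsup_{n\to\infty}F_{n}(S_{n})(\log n)^{-\alpha/d}<\infty\right]=1$$ for every $\alpha>3$.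
   Context: $\log$ denotes the logarithm to base $2$. For a set $A$ and $k\in\mathbb{N}$, $\binom{A}{k}$ is the set of all $k$-element subsets of $A$. Lipschitz constants are taken with respect to the Euclidean metric. For a finite set $X$ the uniform probability measure is $\mathbb{P}_X(A)=|A|/|X|$ for $A\subseteq X$; on a countable product of finite sets one takes the product of these uniform measures. *)

(* Defs.v *)
From HB Require Import structures.
From mathcomp Require Import all_boot all_order all_algebra.
From mathcomp Require Import all_classical all_reals all_analysis.
Set Implicit Arguments. Unset Strict Implicit. Unset Printing Implicit Defensive.
Import Order.TTheory GRing.Theory Num.Theory.
Local Open Scope classical_set_scope.
Local Open Scope ring_scope.

Section Defs.
Variable R : realType.

Definition log2 (x : R) : R := ln x / ln 2.

Definition point (d : nat) := {ffun 'I_d -> int}.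

Definition edist d (x y : point d) : R :=
  Num.sqrt (\sum_(i < d) ((x i - y i)%:~R) ^+ 2).

Definition lip_on d (S : set (point d)) (f : point d -> point d) : R :=
  sup [set r | exists x y, [/\ S x, S y, x <> y &
                 r = edist (f x) (f y) / edist x y]].

Definition in_grid d (n : nat) (y : point d) : Prop :=
  forall i, (1 <= y i)%R /\ (y i <= n%:Z)%R.

Definition surj_onto_grid d (S : set (point d)) (n : nat)
  (f : point d -> point d) : Prop :=
  (forall x, S x -> in_grid n (f x)) /\
  (forall y, in_grid n y -> exists x, S x /\ f x = y).

Definition Fn d (n : nat) (S : set (point d)) : R :=
  inf [set r | exists f, surj_onto_grid S n f /\ r = lip_on S f].

(** {1,...,m}^d, encoded with coordinates shifted by one *)
Definition box (d m : nat) := {ffun 'I_d -> 'I_m}.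
Definition embed d m (p : box d m) : point d := [ffun i => (p i)%:Z + 1].

Definition factor (d m k : nat) := {S : {set box d m} | #|S| == k}.

Definition Omega (d : nat) (m : nat -> nat) := forall n : nat, factor d (m n) (n ^ d).

Record cylinder (d : nat) (m : nat -> nat) := Cyl {
  cyl_N : nat;
  cyl_A : forall n : nat, {set factor d (m n) (n ^ d)} }.

Definition cyl_set d m (C : cylinder d m) : set (Omega d m) :=
  [set w | forall n, (n < cyl_N C)%N -> w n \in cyl_A C n].

Definition cyl_mu d m (C : cylinder d m) : R :=
  \prod_(n < cyl_N C)
     (#|cyl_A C n|%:R / #|[set: factor d (m n) (n ^ d)]|%:R).

(** E is null for the product of the uniform measures (outer measure 0) *)
Definition prod_null d m (E : set (Omega d m)) : Prop :=
  forall eps : R, 0 < eps -> exists C : nat -> cylinder d m,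
    E `<=` \bigcup_i cyl_set (C i) /\
    forall N, \sum_(i < N) cyl_mu (C i) <= eps.

Definition almost_surely d m (E : set (Omega d m)) : Prop :=
  prod_null (~` E).

Definition rand_set d m (w : Omega d m) (n : nat) : set (point d) :=
  (@embed d (m n)) @` [set p | p \in val (w n)].

End Defs.

(* Main.v *)
(** The points are matched cell by cell.  Cut the source and the target cube into [(2 ^ J) ^ d]
    congruent cells, each expected to contain about [(log n) ^ 3] points.  A Chernoff bound for
    sampling without replacement controls the number of points in every box obtained by halving the
    source cube one coordinate after the other.  Replacing, step by step, the average over such a
    box by the averages over its two halves is achieved by a flow between neighbouring cells, and
    since [d >= 2] each of the [J * d] steps sends at most [O(sqrt (log n * L))] through a cell of
    mean content [L].  With [L >= C * (log n) ^ 3] the total flow is smaller than half of a cell, so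
    a single exchange between neighbouring cells equalizes all contents.  Hall's theorem turns this
    fractional transport into a bijection that moves every point, after rescaling, by
    [O((log n) ^ (3 / d))]; distinct lattice points being at distance at least [1], this is also a
    bound for the Lipschitz constant.  The failure probabilities are summable, and [c n] is chosen
    to make the side of the source cube divisible by [2 ^ J]. *)
Require Import Defs.
From HB Require Import structures.
From mathcomp Require Import all_boot all_order all_algebra.
From mathcomp Require Import lra ring zify.
Set Implicit Arguments. Unset Strict Implicit. Unset Printing Implicit Defensive.
Import Order.TTheory GRing.Theory Num.Theory.
Local Open Scope ring_scope.

(** * From fractional matchings and flows to matchings *)

(** Induction on [#|A|]. If some nonempty proper [B] is tight, [B] and [A :\: B] are matched
    separately, the latter outside the neighbourhood of [B]. Otherwise every nonempty proper subset
    has a spare neighbour, so one pair may be matched freely and its target removed. *)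
Lemma hall (X Y : finType) (y0 : Y) (r : X -> {set Y}) (A : {set X}) :
  (forall B : {set X}, B \subset A -> (#|B| <= #|\bigcup_(x in B) r x|)%N) ->
  exists f : X -> Y, {in A &, injective f} /\ {in A, forall x, f x \in r x}.
Proof.
have [k] := ubnP #|A|; elim: k => // k IH in r A *.
rewrite ltnS => leAk hA.
have [->|/set0Pn[x xA]] := eqVneq A set0.
  by exists (fun _ => y0); split=> [x1|x1]; rewrite inE.
have [/existsP[B /and4P[BA B0 nBA tB]]|/existsPn noB] := boolP [exists B : {set X},
   [&& B \subset A, B != set0, B != A & #|\bigcup_(x in B) r x| == #|B|]].
  have ltBA : (#|B| < #|A|)%N by apply: proper_card; rewrite properEneq nBA.
  have [|C CB|f [fI fr]] := IH r B; first exact: leq_trans leAk.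
    by apply: hA; apply: subset_trans BA.
  pose N := \bigcup_(x in B) r x.
  have cB : (0 < #|B|)%N by rewrite card_gt0.
  have [||g [gI gr]] := IH (fun x => r x :\: N) (A :\: B).
  - by rewrite cardsDS //; lia.
  - move=> C CAB.
    have CB0 : [disjoint C & B].
      by apply/pred0P=> z /=; apply/andP=> -[zC zB]; move/subsetP: CAB => /(_ z zC); rewrite inE zB.
    (* Hall's condition for [C :|: B], minus the tight equality for [B], leaves the condition for
       [C]. *)
    have /hA : (C :|: B) \subset A.
      by rewrite subUset BA andbT; apply: subset_trans CAB (subsetDl _ _).
    rewrite cardsU (disjoint_setI0 CB0) cards0 subn0.
    have -> : \bigcup_(x0 in C :|: B) r x0 = (\bigcup_(x0 in C) (r x0 :\: N)) :|: N.
      rewrite bigcup_setU; apply/setP=> y; rewrite !inE -/N.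
      have [yN|yN] := boolP (y \in N); rewrite ?orbT // !orbF.
      by apply/bigcupP/bigcupP=> -[z zC]; rewrite ?inE ?yN => yr; exists z => //; rewrite ?inE ?yN //.
    by move: tB => /eqP tB; rewrite -/N in tB; rewrite cardsU tB; lia.
  exists (fun x => if x \in B then f x else g x); split.
  + move=> x1 x2 A1 A2 /=; have [B1|B1] := boolP (x1 \in B); have [B2|B2] := boolP (x2 \in B).
    * exact: fI.
    * move=> e; have := gr x2; rewrite !inE B2 A2 => /(_ isT) /andP[/negP[]].
      by rewrite -e; apply/bigcupP; exists x1 => //; apply: fr.
    * move=> e; have := gr x1; rewrite !inE B1 A1 => /(_ isT) /andP[/negP[]].
      by rewrite e; apply/bigcupP; exists x2 => //; apply: fr.
    * by apply: gI; rewrite inE ?B1 ?B2.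
  + move=> x1 A1 /=; have [B1|B1] := boolP (x1 \in B); first exact: fr.
    by have := gr x1; rewrite !inE B1 A1 => /(_ isT) /andP[].
have /set0Pn[y yrx] : r x != set0.
  rewrite -card_gt0; have := hA [set x]; rewrite sub1set => /(_ xA).
  by rewrite cards1 big_set1.
have [||f [fI fr]] := IH (fun z => r z :\ y) (A :\ x).
- by have := cardsD1 x A; rewrite xA; lia.
- move=> B BAx; have [->|B0] := eqVneq B set0; first by rewrite cards0.
  have BA : B \subset A by apply: subset_trans BAx (subsetDl _ _).
  have BneA : B != A.
    by apply/eqP=> e; move/subsetP: BAx => /(_ x); rewrite e xA => /(_ isT); rewrite !inE eqxx.
  have := noB B; rewrite BA B0 BneA /= => /negbTE tB.
  have := hA B BA; rewrite leq_eqVlt eq_sym tB /= => lt.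
  have -> : \bigcup_(x0 in B) (r x0 :\ y) = (\bigcup_(x0 in B) r x0) :\ y.
    apply/setP=> z; rewrite !inE; apply/bigcupP/andP.
      by move=> [t tBB]; rewrite !inE => /andP[? ?]; split=> //; apply/bigcupP; exists t.
    by move=> [zy /bigcupP[t tBB tr]]; exists t => //; rewrite !inE zy.
  by have := cardsD1 y (\bigcup_(x0 in B) r x0); case: (_ \in _); lia.
exists (fun z => if z == x then y else f z); split.
+ move=> x1 x2 A1 A2 /=; have [->|e1] := eqVneq x1 x; have [->|e2] := eqVneq x2 x => //.
  * by move=> e; have := fr x2; rewrite !inE e2 A2 => /(_ isT); rewrite -e eqxx.
  * by move=> e; have := fr x1; rewrite !inE e1 A1 => /(_ isT); rewrite e eqxx.
  * by apply: fI; rewrite !inE ?e1 ?e2.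
+ move=> x1 A1 /=; have [->//|e1] := eqVneq x1 x.
  by have := fr x1; rewrite !inE e1 A1 => /(_ isT) /andP[].
Qed.

(** Double counting gives Hall's condition for the support of [w]: the mass [#|B|] leaving [B] lands
    in its neighbourhood, where each point receives at most [1]. *)
Lemma fractional_matching (R : realFieldType) (X Y : finType) (y0 : Y)
    (S : {set X}) (w : X -> Y -> R) :
  (forall x y, 0 <= w x y) ->
  {in S, forall x, \sum_y w x y = 1} -> (forall y, \sum_(x in S) w x y = 1) ->
  exists f : X -> Y, {in S &, injective f} /\ {in S, forall x, 0 < w x (f x)}.
Proof.
move=> w0 wr wc.
have [B BS|f [fI fr]] := hall y0 (r := fun x => [set y | 0 < w x y]) (A := S); last first.
  by exists f; split=> // x /fr; rewrite inE.
set N := \bigcup_(x in B) _.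
rewrite -(ler_nat R).
have -> : #|B|%:R = \sum_(x in B) \sum_(y in N) w x y.
  rewrite -sum1_card natr_sum; apply: eq_bigr => x xB.
  rewrite -(wr x (subsetP BS x xB)) (bigID (mem N)) /= [X in _ + X]big1 ?addr0 // => y yN.
  apply/eqP; rewrite eq_le w0 andbT leNgt; apply: contra yN => wxy.
  by apply/bigcupP; exists x => //; rewrite inE.
rewrite exchange_big /= -sum1_card natr_sum; apply: ler_sum => y _.
rewrite -(wc y) [leRHS](bigID (mem B)) /= [X in _ <= X + _](eq_bigl (mem B)).
  by rewrite lerDl sumr_ge0.
by move=> x /=; rewrite andb_idl // => /(subsetP BS).
Qed.

(* [Z] is a common refinement of the partitions of the target into points and into cells: [2 ^ J]
   need not divide [n], so a target point may belong to several cells. *)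
Lemma matching_through_cells (R : realFieldType) (X Y Z G : finType) (y0 : Y)
    (S : {set X}) (cell : X -> G) (zc : Z -> G) (zy : Z -> Y) (a b : nat)
    (P : G -> G -> R) :
  (0 < a)%N -> (0 < b)%N ->
  (forall g, #|[set z | zc z == g]| = a) ->
  (forall y, #|[set z | zy z == y]| = b) ->
  (forall g h, 0 <= P g h) ->
  (forall g, \sum_h P g h = #|[set x in S | cell x == g]|%:R) ->
  (forall h, \sum_g P g h = a%:R / b%:R) ->
  exists f : X -> Y, {in S &, injective f} /\
    {in S, forall x, exists z, zy z = f x /\ 0 < P (cell x) (zc z)}.
Proof.
move=> a0 b0 ca cb P0 Pr Pc.
have a0' : a%:R != 0 :> R by rewrite pnatr_eq0 -lt0n.
have b0' : b%:R != 0 :> R by rewrite pnatr_eq0 -lt0n.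
pose N g : R := #|[set x in S | cell x == g]|%:R.
(* The mass [P g h] is shared equally by the points of [S] in [g] and the [a] elements of [Z] over
   [h], then collected at the target points. *)
pose w x y := \sum_(z | zy z == y) P (cell x) (zc z) / (N (cell x) * a%:R).
have w0 x y : 0 <= w x y.
  by apply: sumr_ge0 => z _; rewrite divr_ge0 // mulr_ge0 // /N ler0n.
have wr : {in S, forall x, \sum_y w x y = 1}.
  move=> x xS; rewrite /w -(@partition_big _ _ _ _ _ _ xpredT zy xpredT) //=.
  rewrite -mulr_suml (partition_big zc xpredT) //=.
  have -> : \sum_j \sum_(i | zc i == j) P (cell x) (zc i) = N (cell x) * a%:R.
    rewrite /N -Pr mulr_suml; apply: eq_bigr => h _.
    rewrite (eq_bigr (fun=> P (cell x) h)); last by move=> z /eqP ->.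
    by rewrite sumr_const -[LHS]mulr_natr -(ca h) cardsE.
  rewrite divff // mulf_neq0 // /N pnatr_eq0 cards_eq0.
  by apply/set0Pn; exists x; rewrite inE xS /=.
have wc y : \sum_(x in S) w x y = 1.
  rewrite /w exchange_big /= (eq_bigr (fun=> b%:R^-1)).
    by rewrite sumr_const -[#|_|](cardsE) cb -[LHS]mulr_natl divff.
  move=> z _; rewrite (partition_big cell xpredT) //=.
  rewrite (eq_bigr (fun g => P g (zc z) / a%:R)).
    by rewrite -mulr_suml Pc mulrAC divff // mul1r.
  move=> g _.
  rewrite (eq_bigr (fun=> P g (zc z) / (N g * a%:R))); last by move=> x /andP[_ /eqP->].
  rewrite sumr_const (_ : #|_| = #|[set x in S | cell x == g]|); last by apply: eq_card => x; rewrite !inE.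
  rewrite -[LHS]mulr_natl -/(N g).
  (* Division by zero gives an empty cell weight [0]; this agrees with [P], whose row sums to [0]
     there. *)
  have [Ng|Ng] := eqVneq (N g) 0; last by field; rewrite Ng a0'.
  rewrite Ng mul0r; apply/esym; rewrite (_ : P g _ = 0) ?mul0r //.
  have := Pr g; rewrite -/(N g) Ng => /eqP; rewrite psumr_eq0 // => /allP /(_ (zc z)).
  by rewrite mem_index_enum => /(_ isT) /eqP.
have [f [fI fw]] := fractional_matching y0 w0 wr wc.
exists f; split=> // x /fw; rewrite /w => h.
have [z /andP[/eqP zf hz]|no] := pickP (fun z => (zy z == f x) && (0 < P (cell x) (zc z))).
  by exists z.
move: h; rewrite big1 ?ltxx // => z zf; have := no z; rewrite zf /= lt0r P0 andbT => /negbFE/eqP ->.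
by rewrite mul0r.
Qed.

(** Moving mass along [phi] turns [f] into [g]. [B] bounds the total traffic at a cell, in and out
    together, to be compared with the content of the cell. *)
Definition flow (R : realFieldType) (G : finType) (adj : rel G) (f g : G -> R) (B : R) :=
  exists phi : G -> G -> R,
  [/\ forall p q, phi p q = - phi q p, forall p q, ~~ adj p q -> phi p q = 0,
      forall p, \sum_q phi p q = f p - g p & forall p, \sum_q `|phi p q| <= B].

Lemma flow_trans (R : realFieldType) (G : finType) (adj : rel G) (f g h : G -> R) (B C : R) :
  flow adj f g B -> flow adj g h C -> flow adj f h (B + C).
Proof.
move=> [u [ua un us ub]] [v [va vn vs vb]]; exists (fun p q => u p q + v p q); split.
- by move=> p q; rewrite ua va opprD.
- by move=> p q npq; rewrite un // vn // addr0.
- by move=> p; rewrite big_split /= us vs; lra.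
- move=> p; apply: le_trans (lerD (ub p) (vb p)); rewrite -big_split /=.
  by apply: ler_sum => q _; apply: ler_normD.
Qed.

(** When every cell holds at least as much as passes through it, the flow can be carried out at
    once: its positive part moves and the rest [D] stays in place. *)
Lemma flow_transport (R : realFieldType) (G : finType) (adj : rel G) (nu : G -> R) (L B : R) :
  reflexive adj -> flow adj nu (fun=> L) B -> (forall g, B <= nu g) ->
  exists P : G -> G -> R, [/\ forall p q, 0 <= P p q, forall p q, 0 < P p q -> adj p q,
    forall p, \sum_q P p q = nu p & forall q, \sum_p P p q = L].
Proof.
move=> adjr [u [ua un us ub]] nuB.
pose M p q := Num.max (u p q) 0.
pose D p := nu p - \sum_q M p q.
have M0 p q : 0 <= M p q by rewrite /M le_max lexx orbT.
have D0 p : 0 <= D p.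
  rewrite subr_ge0; apply: le_trans (nuB p); apply: le_trans (ub p).
  by apply: ler_sum => q _; rewrite /M ge_max ler_norm normr_ge0.
exists (fun p q => M p q + (p == q)%:R * D p); split.
- by move=> p q; rewrite addr_ge0 // mulr_ge0 // ler0n.
- move=> p q; apply: contraTT => npq; rewrite /M un // maxxx add0r.
  by have [e|] := eqVneq p q; [rewrite e adjr in npq | rewrite mul0r ltxx].
- move=> p; rewrite big_split /= [X in _ + X](bigD1 p) //= eqxx mul1r.
  rewrite [X in _ + (_ + X)]big1 => [|q]; first by rewrite /D; lra.
  by rewrite eq_sym => /negbTE->; rewrite mul0r.
- move=> q; rewrite big_split /= [X in _ + X](bigD1 q) //= eqxx mul1r.
  rewrite [X in _ + (_ + X)]big1 => [|p /negbTE->]; last by rewrite mul0r.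
  (* By antisymmetry [M p q] is the negative part of [u q p], that is [M q p - u q p]. *)
  have : \sum_p M p q = \sum_p M q p - \sum_p u q p.
    rewrite -sumrB; apply: eq_bigr => p _; rewrite /M (ua p q) /Num.max.
    by case: ifP; case: ifP; lra.
  by rewrite us /D; lra.
Qed.

(** * Flows between averages over blocks of cells *)

Definition set_coord d s (Q : {ffun 'I_d -> 'I_s}) (i : 'I_d) (q : 'I_s) :
    {ffun 'I_d -> 'I_s} :=
  [ffun k => if k == i then q else Q k].

Lemma set_coordE d s (Q : {ffun 'I_d -> 'I_s}) i q k :
  set_coord Q i q k = if k == i then q else Q k.
Proof. by rewrite ffunE. Qed.

Lemma set_coord_set d s (Q : {ffun 'I_d -> 'I_s}) i q q' :
  set_coord (set_coord Q i q) i q' = set_coord Q i q'.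
Proof. by apply/ffunP=> k; rewrite !set_coordE; case: eqP. Qed.

Lemma set_coord_id d s (Q : {ffun 'I_d -> 'I_s}) i : set_coord Q i (Q i) = Q.
Proof. by apply/ffunP=> k; rewrite !set_coordE; case: eqP => // ->. Qed.

Definition neighbor d s : rel {ffun 'I_d -> 'I_s} :=
  fun p q => [forall i, (p i <= (q i).+1)%N && (q i <= (p i).+1)%N].

Lemma neighbor_refl d s : reflexive (@neighbor d s).
Proof. by move=> p; apply/forallP=> i; rewrite leqnSn. Qed.

(** Each cell hands the surplus accumulated up to it on its line in direction [i] to the next cell.
    A cell has at most two neighbours on that line, hence the factor [2]. *)
Lemma line_flow (R : realFieldType) d s (i : 'I_d) (f g : {ffun 'I_d -> 'I_s} -> R) (beta : R) :
  (forall p, \sum_q (f (set_coord p i q) - g (set_coord p i q)) = 0) ->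
  (forall p : {ffun 'I_d -> 'I_s}, `|\sum_(q : 'I_s | (q <= p i)%N) (f (set_coord p i q) - g (set_coord p i q))| <= beta) ->
  flow (@neighbor d s) f g (2 * beta).
Proof.
move=> line0 Hb.
pose h p := f p - g p.
pose H (p : {ffun 'I_d -> 'I_s}) := \sum_(q : 'I_s | (q <= p i)%N) h (set_coord p i q).
pose sc (p q : {ffun 'I_d -> 'I_s}) := (q i == (p i).+1 :> nat) && [forall k, (k != i) ==> (p k == q k)].
have scP p q : sc p q -> (q i = (p i).+1 :> nat) /\ forall k, k != i -> p k = q k.
  by move=> /andP[/eqP e /forallP a]; split=> // k ki; move: (a k); rewrite ki => /eqP.
have succ p (F : _ -> R) : \sum_q (sc p q)%:R * F q =
    if insub (p i).+1 is Some q1 then F (set_coord p i q1) else 0.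
  case: insubP => [q1 _ q1E|nlt].
    rewrite (bigD1 (set_coord p i q1)) //= big1 ?addr0.
      rewrite (_ : sc _ _ = true) ?mul1r //; rewrite /sc set_coordE eqxx q1E eqxx.
      by apply/forallP=> k; apply/implyP=> /negbTE ki; rewrite set_coordE ki.
    move=> q; case: (boolP (sc p q)); last by rewrite mul0r.
    move=> /scP[e a] /negP[]; apply/eqP/ffunP=> k; rewrite set_coordE.
    by case: eqP => [->|/eqP ki]; [apply: val_inj; rewrite /= e -q1E | rewrite a].
  rewrite big1 // => q _; case: (boolP (sc p q)); last by rewrite mul0r.
  by move=> /scP[e _]; rewrite -e ltn_ord in nlt.
have pred p (F : _ -> R) : \sum_q (sc q p)%:R * F q =
    if p i == 0%N :> nat then 0 else
    if insub (p i).-1 is Some q1 then F (set_coord p i q1) else 0.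
  case: eqP => [p0|/eqP p0].
    rewrite big1 // => q _; case: (boolP (sc q p)); last by rewrite mul0r.
    by move=> /scP[e _]; rewrite e in p0.
  case: insubP => [q1 _ q1E|]; last by have := ltn_ord (p i); lia.
  rewrite (bigD1 (set_coord p i q1)) //= big1 ?addr0.
    rewrite (_ : sc _ _ = true) ?mul1r //; rewrite /sc set_coordE eqxx q1E.
    rewrite prednK ?lt0n // eqxx.
    by apply/forallP=> k; apply/implyP=> /negbTE ki; rewrite set_coordE ki.
  move=> q; case: (boolP (sc q p)); last by rewrite mul0r.
  move=> /scP[e a] /negP[]; apply/eqP/ffunP=> k; rewrite set_coordE.
  by case: eqP => [->|/eqP ki]; [apply: val_inj; rewrite /= -[RHS]/(val q1) q1E e | rewrite a].
have beta0 (p : {ffun 'I_d -> 'I_s}) : 0 <= beta by apply: le_trans (normr_ge0 _) (Hb p).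
exists (fun p q => (sc p q)%:R * H p - (sc q p)%:R * H q); split.
- by move=> p q; rewrite opprB.
- move=> p q; case: (boolP (sc p q)) => [/scP[e a]|_].
    move=> /negP[]; apply/forallP=> k; have [->|ki] := eqVneq k i; first by rewrite e; lia.
    by rewrite a // leqnSn.
  case: (boolP (sc q p)) => [/scP[e a]|_]; last by rewrite !mul0r subrr.
    move=> /negP[]; apply/forallP=> k; have [->|ki] := eqVneq k i; first by rewrite e; lia.
    by rewrite a // leqnSn.
- move=> p; rewrite sumrB (succ p (fun=> H p)) (pred p H) -[RHS]/(h p).
  (* The last cell of a line has no successor, but there the accumulated surplus is the sum over the
     whole line, which is [0]. *)
  have -> : (if (insub (p i).+1 : option 'I_s) is Some _ then H p else 0) = H p :> R.
    case: insubP => [//|nlt]; rewrite /H -[LHS](line0 p); apply: eq_bigl => q.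
    by rewrite -ltnS (leq_trans (ltn_ord q)) // leqNgt.
  have Hp : H p = \sum_(q : 'I_s | (q < p i)%N) h (set_coord p i q) + h p.
    rewrite /H (bigD1 (p i)) //= set_coord_id addrC; congr (_ + _); apply: eq_bigl => q.
    by rewrite ltn_neqAle andbC.
  case: eqP => [p0|/eqP p0]; first by rewrite Hp big1 ?add0r ?subr0 // => q; rewrite p0.
  case: insubP => [q1 _ q1E|]; last by rewrite (leq_ltn_trans (leq_pred _)) ?ltn_ord.
  rewrite Hp (_ : H (set_coord p i q1) = \sum_(q : 'I_s | (q < p i)%N) h (set_coord p i q)).
    by rewrite addrAC subrr add0r.
  rewrite /H set_coordE eqxx; apply: eq_big => [q|q _]; last by rewrite set_coord_set.
  by rewrite -[nat_of_ord q1]/(val q1) q1E -ltnS prednK ?lt0n.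
- move=> p; have b0 := beta0 p.
  apply: (@le_trans _ _ (\sum_q ((sc p q)%:R * `|H p| + (sc q p)%:R * `|H q|))).
    apply: ler_sum => q _; apply: (le_trans (ler_normB _ _)).
    by rewrite !normrM !normr_nat.
  rewrite big_split /= (succ p (fun=> `|H p|)) (pred p (fun q => `|H q|)).
  rewrite mulr2n mulrDl mul1r; apply: lerD; first by case: insubP => // *; apply: Hb.
  case: eqP => // _; case: insubP => // *; apply: Hb.
Qed.

Lemma card_divn (s c t : nat) : (0 < c)%N -> (c %| s)%N -> (t < s %/ c)%N ->
  #|[set q : 'I_s | (q %/ c)%N == t]| = c.
Proof.
move=> c0 cs ts.
have ms (r : 'I_c) : (t * c + r < s)%N.
  have := ltn_ord r; have := leq_mul ts (leqnn c); rewrite divnK //; lia.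
rewrite -[RHS]card_ord -[RHS](card_imset xpredT (f := fun r => Ordinal (ms r))).
  apply: eq_card => q; rewrite !inE; apply/eqP/imsetP => [e|[r _ ->]].
    exists (Ordinal (ltn_pmod q c0)) => //; apply: val_inj => /=.
    by rewrite -e -divn_eq.
  by rewrite /= divnMDl // divn_small ?addn0.
by move=> r1 r2 /(congr1 val) /= /addnI /val_inj.
Qed.

Definition same_block d s (b : 'I_d -> nat) (p q : {ffun 'I_d -> 'I_s}) :=
  [forall k, (p k %/ b k)%N == (q k %/ b k)%N].

Definition block_avg (R : realFieldType) d s (nu : {ffun 'I_d -> 'I_s} -> R) (b : 'I_d -> nat)
    (p : {ffun 'I_d -> 'I_s}) : R :=
  (\sum_(q | same_block b p q) nu q) / (\prod_k b k)%:R.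

(** Each cell of the slab is counted [b i] times, which cancels the factor [b i] of the block
    volume. The result no longer involves [b i], so halving in direction [i] preserves it. *)
Lemma block_sum_avg (R : realFieldType) d s (nu : {ffun 'I_d -> 'I_s} -> R) (b : 'I_d -> nat) i B t p :
  (forall k, 0 < b k)%N -> (0 < B)%N -> (b i %| B)%N -> (B %| s)%N ->
  \sum_(q : 'I_s | (q %/ B)%N == t) block_avg nu b (set_coord p i q) =
  (\sum_(q : {ffun 'I_d -> 'I_s} |
      [forall k, (k != i) ==> ((p k %/ b k)%N == (q k %/ b k)%N)] && ((q i %/ B)%N == t)) nu q)
  / (\prod_(k | k != i) b k)%:R.
Proof.
move=> b0 B0 bB Bs; rewrite /block_avg -mulr_suml.
rewrite (eq_bigr (fun q => \sum_j if same_block b (set_coord p i q) j then nu j else 0)); last by move=> q _; rewrite big_mkcond.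
rewrite exchange_big /=.
set T := \sum_(j | _ && _) _.
have -> : \sum_j \sum_(q : 'I_s | (q %/ B)%N == t)
    (if same_block b (set_coord p i q) j then nu j else 0) = (b i)%:R * T.
  rewrite /T [in RHS]big_mkcond mulr_sumr; apply: eq_bigr => j _.
  rewrite -big_mkcondr /= sumr_const -[LHS]mulr_natl.
  case: ifP => [/andP[/forallP off jt]|nj].
    congr (_%:R * _); rewrite -(@card_divn s (b i) (j i %/ b i)) //.
    - rewrite cardsE; apply: eq_card => q; rewrite !unfold_in /=; apply/andP/eqP.
        by move=> [_ /forallP/(_ i)]; rewrite set_coordE eqxx => /eqP.
      move=> e; split.
        move: jt; have /dvdnP[c cE] := bB.
        by rewrite cE mulnC !divnMA e => /eqP ->.
      apply/forallP=> k; rewrite set_coordE; have [->|ki] := eqVneq k i; first by rewrite e.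
      by have := off k; rewrite ki.
    - exact: dvdn_trans Bs.
    - by rewrite ltn_divLR // divnK ?ltn_ord //; exact: dvdn_trans Bs.
  rewrite (_ : #|_| = 0%N) ?mul0r ?mulr0 //; apply: eq_card0 => q.
  apply/negbTE; apply: contraFN nj; rewrite unfold_in /= => /andP[qt /forallP sm].
  apply/andP; split.
    by apply/forallP=> k; apply/implyP=> /negbTE ki; have := sm k; rewrite set_coordE ki.
  have := sm i; rewrite set_coordE eqxx => /eqP e.
  move: qt; have /dvdnP[c cE] := bB.
  by rewrite cE mulnC !divnMA e => /eqP ->.
rewrite (bigD1 i) //= natrM.
have bi0 : (b i)%:R != 0 :> R by rewrite pnatr_eq0 -lt0n.
have bk0 : (\prod_(k | k != i) b k)%:R != 0 :> R.
  by rewrite pnatr_eq0 -lt0n prodn_cond_gt0.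
by field; rewrite bk0 bi0.
Qed.

Lemma sum_blocks0 (R : realFieldType) s B (h : 'I_s -> R) T :
  (forall t, \sum_(q : 'I_s | (q %/ B)%N == t) h q = 0) ->
  \sum_(q : 'I_s | (q %/ B < T)%N) h q = 0.
Proof.
move=> h0; elim: T => [|T IH]; first by rewrite big1 // => q; rewrite ltn0.
rewrite (bigID (fun q : 'I_s => (q %/ B)%N == T)) /=.
rewrite [X in X + _](eq_bigl (fun q : 'I_s => (q %/ B)%N == T)); last first.
  by move=> q; case: eqP => [->|]; rewrite ?ltnSn ?andbF.
rewrite h0 add0r -[RHS]IH; apply: eq_bigl => q.
by rewrite ltnS [in RHS]ltn_neqAle andbC.
Qed.

(** Complete segments of length [B] before the one of [t] contribute [0]; at most [B] terms
    remain. *)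
Lemma prefix_blocks (R : realFieldType) s B (h : 'I_s -> R) M (t : 'I_s) :
  (0 < B)%N -> (B %| s)%N ->
  (forall t, \sum_(q : 'I_s | (q %/ B)%N == t) h q = 0) -> (forall q, `|h q| <= M) ->
  `|\sum_(q : 'I_s | (q <= t)%N) h q| <= B%:R * M.
Proof.
move=> B0 Bs h0 hM.
rewrite (bigID (fun q : 'I_s => (q %/ B < t %/ B)%N)) /=.
rewrite (eq_bigl (fun q : 'I_s => (q %/ B < t %/ B)%N)); last first.
  move=> q; rewrite andbC andb_idr // => lt; rewrite leqNgt; apply: contraL lt => lt.
  by rewrite -leqNgt leq_div2r // ltnW.
rewrite sum_blocks0 // add0r; apply: (le_trans (ler_norm_sum _ _ _)).
have -> : B%:R * M = \sum_(q : 'I_s | (q %/ B)%N == (t %/ B)%N) M.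
  rewrite sumr_const -[RHS]mulr_natl; congr (_%:R * _).
  rewrite -[LHS](@card_divn s B (t %/ B)) //; first by rewrite cardsE.
  by rewrite ltn_divLR // divnK ?ltn_ord.
have M0 : 0 <= M by apply: le_trans (normr_ge0 _) (hM t).
rewrite [leRHS]big_mkcond [leLHS]big_mkcond; apply: ler_sum => q _.
case: ifP => [/andP[qt]|_]; last by case: ifP.
rewrite -leqNgt => tq; rewrite eqn_leq tq leq_div2r //=.
Qed.

Lemma flow_halve (R : realFieldType) d s (nu : {ffun 'I_d -> 'I_s} -> R) (b b' : 'I_d -> nat) i (M : R) :
  (forall k, 0 < b k)%N -> (forall k, 0 < b' k)%N -> (b' i %| b i)%N -> (b i %| s)%N ->
  (forall k, k != i -> b' k = b k) ->
  (forall p, `|block_avg nu b' p - block_avg nu b p| <= M) ->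
  flow (@neighbor d s) (block_avg nu b') (block_avg nu b) (2 * ((b i)%:R * M)).
Proof.
move=> b0 b0' bb bs bo hM.
have bl p t : \sum_(q : 'I_s | (q %/ b i)%N == t)
    (block_avg nu b' (set_coord p i q) - block_avg nu b (set_coord p i q)) = 0.
  rewrite sumrB !block_sum_avg //; apply/eqP; rewrite subr_eq0; apply/eqP; congr (_ / _).
    apply: eq_bigl => q; congr (_ && _); apply: eq_forallb => k.
    by case: eqVneq => //= ki; rewrite bo.
  by congr (_%:R); apply: eq_bigr => k ki; rewrite bo.
apply: (line_flow (i := i)) => p.
  rewrite -[RHS](@sum_blocks0 R s (b i) _ s (bl p)); apply: eq_bigl => q.
  by rewrite (leq_ltn_trans (leq_div _ _)) ?ltn_ord.
by apply: (prefix_blocks (B := b i)) => // q; apply: hM.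
Qed.

(* Side lengths, in cells, after [j] rounds of halving all coordinates and [r] further halvings. *)
Definition dyadic_sides d (J j r : nat) : 'I_d -> nat :=
  fun i => if (i < r)%N then (2 ^ (J - j.+1))%N else (2 ^ (J - j))%N.

Lemma eq_block_avg (R : realFieldType) d s (nu : {ffun 'I_d -> 'I_s} -> R) (b b' : 'I_d -> nat) :
  b =1 b' -> block_avg nu b =1 block_avg nu b'.
Proof.
move=> e p; rewrite /block_avg (eq_bigr b' (fun k _ => e k)); congr (_ / _).
by apply: eq_bigl => q; apply: eq_forallb => k; rewrite e.
Qed.

Lemma block_avg1 (R : realFieldType) d s (nu : {ffun 'I_d -> 'I_s} -> R) : block_avg nu (fun=> 1%N) =1 nu.
Proof.
move=> p; rewrite /block_avg [X in _ / X%:R]big1 // divr1 (big_pred1 p) // => q.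
apply/forallP/eqP => [h|-> //]; apply/ffunP=> k; apply: val_inj; apply/eqP.
by have := h k; rewrite !divn1 eq_sym.
Qed.

Lemma flow_ext (R : realFieldType) (G : finType) (a : rel G) (f f' g g' : G -> R) B B' :
  f =1 f' -> g =1 g' -> B = B' -> flow a f g B -> flow a f' g' B'.
Proof.
move=> ef eg <- [u [ua un us ub]]; exists u; split=> // p.
by rewrite us ef eg.
Qed.

Lemma flow_refl (R : realFieldType) (G : finType) (a : rel G) (f : G -> R) : flow a f f 0.
Proof.
exists (fun _ _ => 0); split=> // [p q|p|p]; rewrite ?oppr0 // ?big1 ?subrr // => q _.
by rewrite normr0.
Qed.

(** The allowed deviation is inversely proportional to the side of the block. This cancels the
    length of the segment over which mass moves, so each of the [J * d] halvings costs the same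
    [8 * tau]. *)
Lemma dyadic_flow (R : realFieldType) d J (nu : {ffun 'I_d -> 'I_(2 ^ J)} -> R) (L tau : R) :
  (forall j r p, (j < J)%N -> (r <= d)%N ->
     `|block_avg nu (@dyadic_sides d J j r) p - L| <= tau / (2 ^ (J - j.+1))%:R) ->
  flow (@neighbor d (2 ^ J)) nu (fun=> (\sum_q nu q) / ((2 ^ J) ^ d)%:R) ((J * d)%:R * (8 * tau)).
Proof.
move=> dev.
have step j r : (j < J)%N -> (r <= d)%N ->
    flow (@neighbor d (2 ^ J)) (block_avg nu (@dyadic_sides d J j r)) (block_avg nu (@dyadic_sides d J j 0)) (r%:R * (8 * tau)).
  move=> jJ; elim: r => [|r IH] rd; first by rewrite mul0r; apply: flow_refl.
  rewrite -natr1 mulrDl mul1r addrC; apply: flow_trans (IH (ltnW rd)).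
  set a : R := (2 ^ (J - j.+1))%:R.
  have a0 : a != 0 by rewrite pnatr_eq0 -lt0n expn_gt0.
  have pw : (2 ^ (J - j) = 2 * 2 ^ (J - j.+1))%N by rewrite -expnS subnSK.
  have bE : @dyadic_sides d J j r (Ordinal rd) = (2 ^ (J - j))%N by rewrite /dyadic_sides /= ltnn.
  have bE' : @dyadic_sides d J j r.+1 (Ordinal rd) = (2 ^ (J - j.+1))%N by rewrite /dyadic_sides /= ltnSn.
  (* Two averages within [tau / a] of [L] differ by at most [2 * (tau / a)], and the side being
     halved is [2 * a]; [flow_halve] contributes the remaining factor [2]. *)
  have -> : 8 * tau = 2 * ((@dyadic_sides d J j r (Ordinal rd))%:R * (2 * (tau / a))).
    by rewrite bE pw natrM -/a; field.
  apply: flow_halve => [k|k|||k kr|p].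
  - by rewrite /dyadic_sides; case: ifP; rewrite expn_gt0.
  - by rewrite /dyadic_sides; case: ifP; rewrite expn_gt0.
  - by rewrite bE bE' pw dvdn_mull.
  - by rewrite bE dvdn_exp2l // leq_subr.
  - rewrite /dyadic_sides ltnS leq_eqVlt; case: eqP => // e; case/eqP: kr; exact: val_inj.
  - have := dev j r.+1 p jJ rd; have := dev j r p jJ (ltnW rd); rewrite -/a.
    set x := block_avg _ _ _; set y := block_avg _ _ _ => h1 h2.
    have -> : y - x = (y - L) - (x - L) by ring.
    apply: (le_trans (ler_normB _ _)); lra.
have lev j : (j <= J)%N -> flow (@neighbor d (2 ^ J)) (block_avg nu (fun=> (2 ^ (J - j))%N))
    (block_avg nu (fun=> (2 ^ J)%N)) ((j * d)%:R * (8 * tau)).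
  elim: j => [|j IH] jJ; first by rewrite subn0 mul0n mul0r; apply: flow_refl.
  rewrite mulSn natrD mulrDl; apply: flow_trans (IH (ltnW jJ)).
  apply: flow_ext (step j d jJ (leqnn d)) => //.
  by apply: eq_block_avg => i; rewrite /dyadic_sides ltn_ord.
apply: flow_ext (lev J (leqnn J)) => // p.
  by rewrite subnn expn0 block_avg1.
rewrite /block_avg prod_nat_const card_ord; congr (_ / _); apply: eq_bigl => q.
by apply/forallP => k; rewrite !divn_small.
Qed.

(** * Cells of lattice points and the matching obtained from balanced counts *)

Lemma coarse_lt m k s (hm : m = (s * k)%N) (x : 'I_m) : (x %/ k < s)%N.
Proof.
have := ltn_ord x; case: k hm => [|k] hm; first by rewrite {2}hm muln0.
by rewrite {2}hm ltn_divLR.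
Qed.

Definition coarse d m k s (hm : m = (s * k)%N) (x : {ffun 'I_d -> 'I_m}) : {ffun 'I_d -> 'I_s} :=
  [ffun i => Ordinal (coarse_lt hm (x i))].

Lemma coarseE d m k s (hm : m = (s * k)%N) (x : {ffun 'I_d -> 'I_m}) i :
  coarse hm x i = (x i %/ k)%N :> nat.
Proof. by rewrite ffunE. Qed.

Lemma card_box d m (c t : 'I_d -> nat) :
  (forall i, 0 < c i)%N -> (forall i, c i %| m)%N -> (forall i, t i < m %/ c i)%N ->
  #|[set x : {ffun 'I_d -> 'I_m} | [forall i, (x i %/ c i)%N == t i]]| = (\prod_i c i)%N.
Proof.
move=> c0 cm tm.
rewrite -(eq_bigr _ (fun i _ => card_divn (c0 i) (cm i) (tm i))).
transitivity #|family (fun i => [set q : 'I_m | (q %/ c i)%N == t i])|.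
  apply: eq_card => x; rewrite inE; apply: eq_forallb => i.
  by rewrite /= inE.
by rewrite card_family foldrE big_map big_enum.
Qed.

Definition block d m k s (hm : m = (s * k)%N) (b : 'I_d -> nat) (p : {ffun 'I_d -> 'I_s}) :=
  [set x : {ffun 'I_d -> 'I_m} | same_block b (coarse hm x) p].

Lemma card_block d m k s (hm : m = (s * k)%N) (b : 'I_d -> nat) p :
  (0 < k)%N -> (forall i, 0 < b i)%N -> (forall i, b i %| s)%N ->
  #|block hm b p| = (k ^ d * \prod_i b i)%N.
Proof.
move=> k0 b0 bs.
have -> : (k ^ d * \prod_i b i = \prod_(i < d) (k * b i))%N.
  by rewrite big_split /= prod_nat_const card_ord.
rewrite -(@card_box d m (fun i => k * b i)%N (fun i => p i %/ b i)%N).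
- by apply: eq_card => x; rewrite !inE; apply: eq_forallb => i; rewrite coarseE divnMA.
- by move=> i; rewrite muln_gt0 k0 b0.
- by move=> i; rewrite hm mulnC dvdn_mul.
- move=> i; rewrite hm mulnC divnMl // ltn_divLR // divnK //.
Qed.

Lemma card_coarse_fiber d m k s (hm : m = (s * k)%N) (p : {ffun 'I_d -> 'I_s}) :
  (0 < k)%N -> #|[set x | coarse hm x == p]| = (k ^ d)%N.
Proof.
move=> k0; have := card_block hm (b := fun=> 1%N) p k0.
rewrite [X in (_ * X)%N]big1 // muln1 => <- //.
apply: eq_card => x; rewrite !inE; apply/eqP/forallP => [-> //|h].
by apply/ffunP=> i; apply: val_inj; have := h i; rewrite !divn1 => /eqP.
Qed.

Lemma block_count (R : realFieldType) d m k s (hm : m = (s * k)%N) (b : 'I_d -> nat) p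
    (S : {set {ffun 'I_d -> 'I_m}}) :
  \sum_(q | same_block b q p) #|[set x in S | coarse hm x == q]|%:R = #|S :&: block hm b p|%:R :> R.
Proof.
rewrite -natr_sum; congr (_%:R).
rewrite -[RHS]sum1_card (partition_big (coarse hm) (fun q => same_block b q p)) /=.
  apply: eq_bigr => q sq; rewrite -sum1_card; apply: eq_bigl => x; rewrite !inE.
  by case: eqP => [->|]; rewrite ?andbF // sq !andbT.
by move=> x; rewrite !inE => /andP[].
Qed.

(** The flow stays below [L / 2] while every cell contains at least [L / 2], so [flow_transport]
    applies and each point goes to its own or an adjacent cell. The two inequalities are
    [|f x i / n - x i / m| <= 3 / 2 ^ J] cleared of denominators. *)
Lemma spread_matching (R : realFieldType) d m n k J (hm : m = (2 ^ J * k)%N)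
    (S : {set {ffun 'I_d -> 'I_m}}) (tau : R) :
  let L := (n ^ d)%:R / ((2 ^ J) ^ d)%:R in
  (0 < k)%N -> (2 ^ J <= n)%N -> #|S| = (n ^ d)%N ->
  (forall j r p, (j < J)%N -> (r <= d)%N ->
     `|#|S :&: block hm (@dyadic_sides d J j r) p|%:R / (\prod_i @dyadic_sides d J j r i)%:R - L|
       <= tau / (2 ^ (J - j.+1))%:R) ->
  (J * d)%:R * (8 * tau) <= L / 2 -> tau <= L / 2 ->
  exists f : {ffun 'I_d -> 'I_m} -> {ffun 'I_d -> 'I_n}, {in S &, injective f} /\
    {in S, forall x i, (f x i * m <= x i * n + 3 * (k * n))%N /\
                       (x i * n <= f x i * m + 3 * (k * n))%N}.
Proof.
move=> L k0 sn cS dev small1 small2.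
have s0 : (0 < 2 ^ J)%N by rewrite expn_gt0.
have n0 : (0 < n)%N by apply: leq_trans sn.
pose nu q : R := #|[set x in S | coarse hm x == q]|%:R.
have snu b p : \sum_(q | same_block b q p) nu q = #|S :&: block hm b p|%:R by apply: block_count.
have sym b (p q : {ffun 'I_d -> 'I_(2 ^ J)}) : same_block b p q = same_block b q p.
  by apply: eq_forallb => i; rewrite eq_sym.
have avgE b p : block_avg nu b p = #|S :&: block hm b p|%:R / (\prod_i b i)%:R.
  by rewrite -snu /block_avg; congr (_ / _); apply: eq_bigl => q; rewrite sym.
have tot : \sum_q nu q = (n ^ d)%:R.
  rewrite -cS /nu -natr_sum -[in RHS]sum1_card (partition_big (coarse hm) predT) //=.
  congr (_%:R); apply: eq_bigr => q _; rewrite -sum1_card; apply: eq_bigl => x.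
  by rewrite !inE.
have dev' j r p : (j < J)%N -> (r <= d)%N ->
     `|block_avg nu (@dyadic_sides d J j r) p - L| <= tau / (2 ^ (J - j.+1))%:R.
  by move=> jJ rd; rewrite avgE; apply: dev.
have fl := dyadic_flow dev'; rewrite tot -/L in fl.
have L0 : 0 <= L by rewrite divr_ge0 ?ler0n.
have nuL p : (J * d)%:R * (8 * tau) <= nu p.
  (* Unit blocks occur at [j = J - 1], [r = d], which presupposes [J > 0]; for [J = 0] the only cell
     has content exactly [L]. *)
  apply: (le_trans small1); case: (posnP J) => [J0|J0].
    have : nu p = L.
      rewrite /L -tot [X in X%:R^-1](_ : _ = 1%N); last by rewrite J0 exp1n.
      rewrite divr1 (big_pred1 p) // => q.
      apply/esym/eqP/ffunP=> i; apply: val_inj; apply/eqP.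
      have s1 : (2 ^ J <= 1)%N by rewrite J0.
      have := leq_trans (ltn_ord (p i)) s1; have := leq_trans (ltn_ord (q i)) s1.
      by rewrite !ltnS !leqn0 => /eqP e1 /eqP e2; rewrite /= e1 e2.
    by move=> ->; lra.
  have := dev' J.-1 d p; rewrite (@eq_block_avg _ _ _ nu _ (fun=> 1%N)).
    rewrite prednK // subnn expn0 leqnn => /(_ isT (leqnn d)).
    by rewrite block_avg1 ler_norml divr1 => /andP[h _]; lra.
  by move=> i; rewrite /dyadic_sides ltn_ord prednK // subnn.
have [P [P0 Pa Pr Pc]] := flow_transport (@neighbor_refl d (2 ^ J)) fl nuL.
have hz : (2 ^ J * n = n * 2 ^ J)%N by rewrite mulnC.
(* The refinement is the grid of side [2 ^ J * n]: dividing a coordinate by [n] gives the cell, by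
   [2 ^ J] the target point. *)
have [||||f [fI fP]] := @matching_through_cells R _ _ {ffun 'I_d -> 'I_(2 ^ J * n)} _
    [ffun=> Ordinal n0] S (coarse hm) (coarse (erefl (2 ^ J * n)%N)) (coarse hz)
    (n ^ d) ((2 ^ J) ^ d) P _ _ _ _ P0 Pr Pc.
- by rewrite expn_gt0 n0.
- by rewrite expn_gt0 s0.
- by move=> g; apply: card_coarse_fiber.
- by move=> g; apply: card_coarse_fiber.
exists f; split=> // x xS i.
have [z [zf /Pa /forallP/(_ i)]] := fP x xS.
rewrite !coarseE -zf coarseE => /andP[].
set s := (2 ^ J)%N; have hm' : m = (s * k)%N := hm; have s0' : (0 < s)%N := s0.
have sn' : (s <= n)%N := sn.
have := divn_eq (x i) k; have := ltn_pmod (x i) k0.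
have := divn_eq (z i) n; have := ltn_pmod (z i) n0.
have := divn_eq (z i) s; have := ltn_pmod (z i) s0'.
set x' := (x i %/ k)%N; set q := (z i %/ n)%N; set y := (z i %/ s)%N.
move: (nat_of_ord (z i)) (nat_of_ord (x i)) x' q y (z i %% s)%N (z i %% n)%N (x i %% k)%N.
clearbody s; rewrite hm'; clear -k0 s0' sn' n0.
move=> zi xi x' q y r1 r2 r3 h1 e1 h2 e2 h3 e3 a1 a2.
(* At most three errors of size [k * n] add up: the position of the point in its cell, the step to
   an adjacent cell, and the width of a target point, at most that of a cell because [s <= n]. *)
have a1' : (x' * n <= q.+1 * n)%N by rewrite leq_mul2r a1 orbT.
have a2' : (q * n <= x'.+1 * n)%N by rewrite leq_mul2r a2 orbT.
have b1 : (y * s * k <= (x'.+1 * n + n) * k)%N by rewrite leq_mul2r; apply/orP; right; lia.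
have b2 : ((x' * n) * k <= (y * s + s + n) * k)%N by rewrite leq_mul2r; apply/orP; right; lia.
have b3 : (r3 * n <= k * n)%N by rewrite leq_mul2r ltnW ?orbT.
have b4 : (s * k <= n * k)%N by rewrite leq_mul2r sn' orbT.
rewrite e3; split; nia.
Qed.

(** * Sampling without replacement *)

(** A [k]-sample avoids [t] given elements with probability at most [(1 - k / M) ^ t], as under
    independence, since each conditional factor [(M - t - k) / (M - t)] is at most [(M - k) / M]. *)
Lemma bin_avoid M k t : (k <= M)%N -> (t <= M)%N ->
  ('C(M - t, k) * M ^ t <= 'C(M, k) * (M - k) ^ t)%N.
Proof.
move=> kM; elim: t => [|t IH] tM; first by rewrite subn0 !expn0.
have Mt : (0 < M - t)%N by rewrite subn_gt0.
have eq : ((M - t) * 'C(M - t.+1, k) = (M - t - k) * 'C(M - t, k))%N.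
  by rewrite subnS mul_bin_down.
rewrite -(leq_pmul2l Mt) mulnA eq.
apply: (@leq_trans ((M - t - k) * M * ('C(M, k) * (M - k) ^ t))).
  rewrite expnS [leqLHS](_ : _ = (M - t - k) * M * ('C(M - t, k) * M ^ t))%N; last by nia.
  by rewrite leq_mul2l IH ?orbT // ltnW.
rewrite expnS [leqRHS](_ : _ = (M - t) * (M - k) * ('C(M, k) * (M - k) ^ t))%N; last by nia.
by rewrite leq_mul2r; apply/orP; right; nia.
Qed.

Lemma card_avoid (T : finType) k (J : {set T}) :
  #|[set S : {set T} | (#|S| == k) && [disjoint J & S]]| = 'C(#|T| - #|J|, k).
Proof.
have -> : (#|T| - #|J| = #|~: J|)%N by rewrite (cardsCs (~: J)) setCK.
rewrite -cards_draws; apply: eq_card => S; rewrite !inE andbC.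
by rewrite disjoint_sym disjoints_subset.
Qed.

(** The product expands into a nonnegative combination of indicators that [S] avoids a set [J];
    [bin_avoid] compares each with the independent case, where the expansion folds back into a
    power. *)
Lemma sum_prod_avoid (R : realFieldType) (T : finType) k (a b : R) (B : {set T}) :
  0 <= a -> 0 <= b -> (k <= #|T|)%N -> (0 < #|T|)%N ->
  \sum_(S : {set T} | #|S| == k) \prod_(t in B) (a + b * (t \notin S)%:R) <=
  'C(#|T|, k)%:R * (a + b * ((#|T| - k)%:R / #|T|%:R)) ^+ #|B|.
Proof.
move=> a0 b0 kM M0; set q : R := _ / _.
have q0 : 0 <= q by rewrite divr_ge0 ?ler0n.
pose F (t : T) : R := if t \in B then b else 0.
pose G (t : T) : R := if t \in B then a else 1.
pose c (J : {set T}) := \prod_t (if t \in J then F t else G t).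
have expand (x : T -> R) : \prod_(t in B) (a + b * x t) =
    \sum_(J : {set T}) c J * \prod_(t in J) x t.
  rewrite big_mkcond /= (eq_bigr (fun t => F t * x t + G t)).
    rewrite bigA_distr; apply: eq_bigr => J _.
    rewrite /c [\prod_(t in J) _]big_mkcond -big_split; apply: eq_bigr => t _ /=.
    by case: ifP; rewrite ?mulr1.
  by move=> t _; rewrite /F /G; case: ifP; rewrite ?mul0r ?add0r // addrC.
have c0 J : 0 <= c J.
  by apply: prodr_ge0 => t _; rewrite /F /G; case: ifP; case: ifP.
under eq_bigr do rewrite expand.
rewrite exchange_big /=.
have -> : (a + b * q) ^+ #|B| = \sum_(J : {set T}) c J * q ^+ #|J|.
  by rewrite -prodr_const expand; apply: eq_bigr => J _; rewrite prodr_const.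
rewrite mulr_sumr; apply: ler_sum => J _.
rewrite -mulr_sumr mulrCA ler_wpM2l //.
have -> : \sum_(S : {set T} | #|S| == k) \prod_(t in J) ((t \notin S)%:R : R) =
   'C(#|T| - #|J|, k)%:R.
  rewrite -card_avoid -sum1_card natr_sum big_mkcond [RHS]big_mkcond /=.
  apply: eq_bigr => S _; rewrite inE; case: eqP => //= _.
  have [dis|ndis] := boolP [disjoint J & S].
    by rewrite big1 // => t tJ; rewrite (disjointFr dis tJ).
  have /pred0Pn[t /andP[/= tJ tS]] := ndis.
  by rewrite (bigD1 t) //= tS mul0r.
rewrite /q expr_div_n mulrA ler_pdivlMr ?exprn_gt0 ?ltr0n //.
by rewrite -!natrX -!natrM ler_nat bin_avoid // max_card.
Qed.

Lemma hypergeometric_mgf (R : realFieldType) (T : finType) k (s : R) (B : {set T}) :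
  -1 < s -> (k <= #|T|)%N -> (0 < #|T|)%N ->
  \sum_(S : {set T} | #|S| == k) (1 + s) ^+ #|S :&: B| <=
  'C(#|T|, k)%:R * (1 + s * (k%:R / #|T|%:R)) ^+ #|B|.
Proof.
move=> s1 kM M0.
have M0' : #|T|%:R != 0 :> R by rewrite pnatr_eq0 -lt0n.
have powE (S : {set T}) : (1 + s) ^+ #|S :&: B| = \prod_(t in B) (1 + s * (t \in S)%:R).
  rewrite -prodr_const big_mkcond [RHS]big_mkcond; apply: eq_bigr => t _ /=.
  by rewrite inE; case: (t \in S); case: (t \in B); rewrite /= ?mulr1 ?mulr0 ?addr0.
(* To keep coefficients nonnegative, the complement of [S] is sampled for [s >= 0], and for [s < 0]
   the factor is written as [(1 + s) - s * (t \notin S)]. *)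
have [s0|s0] := leP 0 s.
  have := @sum_prod_avoid R T (#|T| - k) 1 s B ler01 s0 (leq_subr _ _) M0.
  rewrite subKn // bin_sub //; apply: le_trans.
  rewrite (reindex_inj (inv_inj (@setCK T))) /=.
  rewrite le_eqVlt; apply/orP; left; apply/eqP; apply: eq_big => S.
    by rewrite (cardsCs (~: S)) setCK; apply/eqP/eqP => [<-|->]; rewrite subKn ?max_card.
  by move=> _; rewrite powE; apply: eq_bigr => t _; rewrite inE.
have := @sum_prod_avoid R T k (1 + s) (- s) B _ _ kM M0.
have -> : 1 + s + - s * ((#|T| - k)%:R / #|T|%:R) = 1 + s * (k%:R / #|T|%:R).
  by rewrite natrB //; field.
move=> h; apply: le_trans (h _ _); [|lra|lra].
rewrite le_eqVlt; apply/orP; left; apply/eqP; apply: eq_bigr => S _.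
rewrite powE; apply: eq_bigr => t _; case: (t \in S); rewrite /= ?mulr1 ?mulr0 ?addr0 //; ring.
Qed.

(* Only here, since [classical_sets] shadows names of [finset]. *)
From mathcomp Require Import all_classical all_reals all_analysis.

(** Markov's inequality for [(1 + s) ^+ #|S :&: B|]. The slope [s / (1 + s)] bounds [ln (1 + s)]
    from below for either sign of [s], so one statement serves both tails. *)
Lemma hypergeometric_exp (R : realType) (T : finType) k (s x : R) (B : {set T}) (A : {set {set T}}) :
  -1 < s -> (k <= #|T|)%N -> (0 < #|T|)%N ->
  (forall S, S \in A -> #|S| = k /\ x <= #|S :&: B|%:R * (s / (1 + s))) ->
  #|A|%:R <= 'C(#|T|, k)%:R * expR (s * (k%:R * #|B|%:R / #|T|%:R) - x).
Proof.
move=> s1 kM M0 hA.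
have s10 : 0 < 1 + s by lra.
have th n : expR (n%:R * (s / (1 + s))) <= (1 + s) ^+ n.
  rewrite expRM_natl; apply: lerXn2r; rewrite ?nnegrE ?expR_ge0 //; first exact: ltW.
  have := expR_ge1Dx (- (s / (1 + s))); rewrite expRN.
  have -> : 1 + - (s / (1 + s)) = (1 + s)^-1 by field; lra.
  by rewrite lef_pV2 // posrE ?expR_gt0.
rewrite expRD expRN mulrA ler_pdivlMr ?expR_gt0 //.
apply: (@le_trans _ _ (\sum_(S : {set T} | #|S| == k) (1 + s) ^+ #|S :&: B|)).
  rewrite -sum1_card natr_sum mulr_suml [leRHS]big_mkcond [leLHS]big_mkcond /=.
    apply: ler_sum => S _; case: ifP => SA.
    have [-> hx] := hA S SA; rewrite eqxx mul1r; apply: le_trans (th _).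
    by rewrite ler_expR.
  by case: ifP => // _; rewrite exprn_ge0 // ltW.
apply: le_trans (hypergeometric_mgf _ _ _ _) _ => //.
rewrite ler_wpM2l ?ler0n //.
rewrite (_ : s * _ = s * (k%:R / #|T|%:R) * #|B|%:R); last by ring.
rewrite expRM_natr; apply: lerXn2r; rewrite ?nnegrE ?expR_ge0 ?expR_ge1Dx //.
have : k%:R / #|T|%:R <= 1 :> R by rewrite ler_pdivrMr ?ltr0n // mul1r ler_nat.
have : 0 <= k%:R / #|T|%:R :> R by rewrite divr_ge0.
nra.
Qed.

Lemma hypergeometric_tail (R : realType) (T : finType) k (delta : R) (B : {set T}) :
  let E := k%:R * #|B|%:R / #|T|%:R in
  0 < delta -> delta <= 1 -> (k <= #|T|)%N -> (0 < #|T|)%N ->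
  #|[set S : {set T} | (#|S| == k) && (delta * E < `|#|S :&: B|%:R - E|)]|%:R <=
  2 * 'C(#|T|, k)%:R * expR (- (E * delta ^+ 2 / 6)).
Proof.
move=> E d0 d1 kM M0.
have E0 : 0 <= E by rewrite divr_ge0 ?mulr_ge0 ?ler0n.
have Ed0 : 0 <= E * delta ^+ 2 by exact: mulr_ge0 E0 (exprn_ge0 _ (ltW d0)).
pose U := [set S : {set T} | (#|S| == k) && ((1 + delta) * E <= #|S :&: B|%:R)].
pose V := [set S : {set T} | (#|S| == k) && (#|S :&: B|%:R <= (1 - delta) * E)].
have hU : #|U|%:R <= 'C(#|T|, k)%:R * expR (- (E * delta ^+ 2 / 6)).
  have s0 : 0 < 1 + delta / 2 by lra.
  (* The tilt [delta / 2] yields the exponent [- E * delta ^+ 2 / (4 * (1 + delta / 2))], whose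
     denominator is at most [6] because [delta <= 1]. *)
  have := @hypergeometric_exp R T k (delta / 2)
    ((1 + delta) * E * ((delta / 2) / (1 + delta / 2))) B U _ kM M0.
  move=> h; apply: le_trans (h _ _) _; first by lra.
    move=> S; rewrite inE => /andP[/eqP-> h1]; split=> //.
    by rewrite ler_wpM2r // divr_ge0; lra.
  rewrite ler_wpM2l ?ler0n // ler_expR -/E.
  have -> : delta / 2 * E - (1 + delta) * E * (delta / 2 / (1 + delta / 2)) =
     - (E * delta ^+ 2 * (1 / (4 * (1 + delta / 2)))) by field; lra.
  rewrite lerN2 ler_wpM2l //.
  by rewrite mul1r lef_pV2 ?posrE; lra.
have hV : #|V|%:R <= 'C(#|T|, k)%:R * expR (- (E * delta ^+ 2 / 6)).
  have s0 : 0 < 1 - delta / 2 by lra.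
  have := @hypergeometric_exp R T k (- (delta / 2))
    ((1 - delta) * E * (- (delta / 2) / (1 - delta / 2))) B V _ kM M0.
  move=> h; apply: le_trans (h _ _) _; first by lra.
    move=> S; rewrite inE => /andP[/eqP-> h1]; split=> //.
    rewrite !mulNr !mulrN lerN2 ler_wpM2r // divr_ge0; lra.
  rewrite ler_wpM2l ?ler0n // ler_expR -/E.
  have -> : - (delta / 2) * E - (1 - delta) * E * (- (delta / 2) / (1 - delta / 2)) =
     - (E * delta ^+ 2 * (1 / (4 * (1 - delta / 2)))) by field; lra.
  rewrite lerN2 ler_wpM2l //.
  by rewrite mul1r lef_pV2 ?posrE; lra.
apply: (@le_trans _ _ (#|U|%:R + #|V|%:R)); last by lra.
rewrite -natrD ler_nat; apply: leq_trans (leq_card_setU U V).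
apply: subset_leq_card; apply/fintype.subsetP=> S; rewrite !inE => /andP[->] /=.
by rewrite lter_normr => /orP[] h; apply/orP; [left|right]; lra.
Qed.

(** * Lipschitz constants *)

Lemma embed_inj d m : injective (@embed d m).
Proof.
move=> p q /ffunP e; apply/ffunP=> i; apply: val_inj.
by have := e i; rewrite !ffunE => /addIr [].
Qed.

Lemma embed_in_grid d n (p : box d n) : in_grid n (embed p).
Proof. by move=> i; rewrite ffunE; have := ltn_ord (p i); split; lia. Qed.

Lemma in_gridP d n (y : Defs.point d) : in_grid n y -> exists p : box d n, embed p = y.
Proof.
move=> yg.
have lt i : (absz (y i - 1) < n)%N by have [] := yg i; lia.
exists [ffun i => Ordinal (lt i)]; apply/ffunP=> i; rewrite !ffunE /=.
by have [] := yg i; lia.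
Qed.

Lemma edist_ge1 (R : realType) d (x y : Defs.point d) : x <> y -> 1 <= Defs.edist R x y.
Proof.
move=> xy; rewrite /Defs.edist -[leLHS]sqrtr1; apply: ler_wsqrtr.
have [i xyi] : exists i, x i != y i.
  apply/existsP; rewrite -negb_forall; apply/negP => /forallP h; apply: xy.
  by apply/ffunP=> i; apply/eqP.
rewrite (bigD1 i) //= -[leLHS]addr0 lerD ?sumr_ge0 // => [|k _]; last exact: sqr_ge0.
rewrite -rmorphXn /= ler1z -gtz0_ge1 exprn_even_gt0 //= subr_eq0 //.
Qed.

Lemma edist_coord (R : realType) d (x y : Defs.point d) i :
  `|(x i - y i)%:~R| <= Defs.edist R x y :> R.
Proof.
rewrite /Defs.edist -sqrtr_sqr; apply: ler_wsqrtr.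
by rewrite (bigD1 i) //= lerDl sumr_ge0 // => k _; exact: sqr_ge0.
Qed.

Lemma edist_le (R : realType) d (x y : Defs.point d) (K : R) : 0 <= K ->
  (forall i, `|(x i - y i)%:~R| <= K) -> Defs.edist R x y <= d%:R * K.
Proof.
move=> K0 h; rewrite /Defs.edist -[leRHS]ger0_norm ?mulr_ge0 // -sqrtr_sqr.
apply: ler_wsqrtr; apply: (@le_trans _ _ (\sum_(i < d) K ^+ 2)).
  by apply: ler_sum => i _; rewrite -real_normK ?num_real // lerXn2r ?nnegrE.
rewrite sumr_const card_ord -[leLHS]mulr_natl exprMn ler_wpM2r ?sqr_ge0 //.
by rewrite -natrX ler_nat -mulnn; case: (d) => // k; rewrite leq_pmulr.
Qed.

(** Distinct points are at distance at least [1], so the additive error [D] becomes a factor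
    [1 + D]; the factor [d] compares the Euclidean with the maximum norm. Equal cardinals make the
    injection surjective. *)
Lemma Fn_le (R : realType) d m n (S : {set box d m}) (f : box d m -> box d n) (D : R) :
  0 <= D -> #|S| = (n ^ d)%N -> {in S &, injective f} ->
  (forall p q i, p \in S -> q \in S ->
     `|(f p i)%:R - (f q i)%:R| <= `|(p i)%:R - (q i)%:R| + D) ->
  Fn R n (((@embed d m) @` [set p | p \in S])%classic) <= d%:R * (1 + D).
Proof.
move=> D0 cS fI fD; set A := (_ @` _)%classic.
pose g (x : Defs.point d) : Defs.point d :=
  if [pick p in S | embed p == x] is Some p then embed (f p) else x.
have gE p : p \in S -> g (embed p) = embed (f p).
  move=> pS; rewrite /g; case: pickP => [q /andP[_ /eqP/embed_inj -> //]|/(_ p)].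
  by rewrite pS eqxx.
have gs : surj_onto_grid A n g.
  split=> [_ [p /= pS <-]|y /in_gridP[q <-]]; first by rewrite gE //; apply: embed_in_grid.
  have : q \in f @: S.
    suff -> : f @: S = [set: box d n]%SET by rewrite inE.
    apply/eqP; rewrite eqEcard finset.subsetT /= card_in_imset // cardsT cS.
    by rewrite card_ffun !card_ord.
  by case/imsetP=> p pS ->; exists (embed p); split; [exists p|rewrite gE].
have K0 : 0 <= d%:R * (1 + D) by rewrite mulr_ge0 // addr_ge0.
have lipg : lip_on R A g <= d%:R * (1 + D).
  rewrite /lip_on; set E := [set r | _]%classic.
  have [->|/set0P E0] := eqVneq E set0; first by rewrite sup0.
  apply: ge_sup => // r [_ [_ [[p /= pS <-] [q /= qS <-] pq ->]]].
  have e1 := @edist_ge1 R _ _ _ pq.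
  rewrite !gE // ler_pdivrMr ?(lt_le_trans ltr01) // -mulrA.
  apply: edist_le; first by rewrite mulr_ge0 ?addr_ge0 // (le_trans ler01).
  have emb k (u v : box d k) i : (embed u i - embed v i)%:~R = (u i)%:R - (v i)%:R :> R.
    by rewrite !ffunE opprD addrACA subrr addr0 rmorphB.
  move=> i; have := @edist_coord R _ (embed p) (embed q) i.
  rewrite !emb => c1; apply: (le_trans (fD _ _ _ pS qS)).
  rewrite mulrDl mul1r lerD // ler_peMr //.
apply: le_trans lipg; apply: ge_inf; last by exists g.
(* The infimum needs a lower bound: [lip_on] is nonnegative, also when the supremum takes its
   default value [0]. *)
exists 0 => _ [h [_ ->]]; rewrite /lip_on; set E := [set r | _]%classic.
have [hE|/sup_out ->//] := pselect (has_sup E).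
have [[r Er] hb] := hE; apply: (@le_trans _ _ r); last exact: sup_ubound.
by have [x [y [_ _ _ ->]]] := Er; rewrite divr_ge0 // sqrtr_ge0.
Qed.

(** * Good samples *)

Lemma card_exists_le (T U : finType) (P : T -> pred U) :
  (#|[set u | [exists t, P t u]]| <= \sum_t #|[set u | P t u]|)%N.
Proof.
rewrite -sum1_card big_mkcond /=.
have -> : (\sum_t #|[set u | P t u]| = \sum_u \sum_t P t u)%N.
  rewrite exchange_big; apply: eq_bigr => t _; rewrite -sum1_card big_mkcond /=.
  by apply: eq_bigr => u _; rewrite inE; case: (P t u).
apply: leq_sum => u _; rewrite inE; case: existsP => // -[t Pt].
by rewrite (bigD1 t) //= Pt.
Qed.

Definition bad_samples (R : realType) (d M n k J : nat) (hm : M = (2 ^ J * k)%N) (tau : R) :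
    {set Defs.factor d M (n ^ d)%N} :=
  [set S | [exists t : 'I_J * 'I_d.+1 * {ffun 'I_d -> 'I_(2 ^ J)},
    tau / (2 ^ (J - t.1.1.+1))%:R <
    `|#|val S :&: block hm (@dyadic_sides d J t.1.1 t.1.2) t.2|%:R / (\prod_i @dyadic_sides d J t.1.1 t.1.2 i)%:R
      - (n ^ d)%:R / ((2 ^ J) ^ d)%:R|]].

Lemma card_factor d M K : #|[set: Defs.factor d M K]| = 'C(M ^ d, K).
Proof.
rewrite cardsT card_sig -[RHS](_ : 'C(#|box d M|, K) = _); last by rewrite card_ffun !card_ord.
by rewrite -card_draws; apply: eq_card => S; rewrite !inE.
Qed.

(** Union bound over stages and blocks. A block of [V] cells has mean [L * V], and the relative
    deviation [delta] gives the exponent [K * (V / a ^ 2) / 6]. It is at least [K / 6] because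
    [V >= a ^ d >= a ^ 2]; this is where [2 <= d] enters. *)
Lemma card_bad (R : realType) (d M n k J : nat) (hm : M = (2 ^ J * k)%N) (tau K : R) :
  let L := (n ^ d)%:R / ((2 ^ J) ^ d)%:R in
  (2 <= d)%N -> (0 < n)%N -> (0 < k)%N -> (n <= M)%N -> 0 < tau -> tau <= L -> tau ^+ 2 = K * L ->
  #|bad_samples d n hm tau|%:R <= (J * d.+1 * (2 ^ J) ^ d)%:R * (2 * expR (- (K / 6))) *
    #|[set: Defs.factor d M (n ^ d)%N]|%:R.
Proof.
move=> L d2 n0 k0 nM tau0 tauL tau2.
rewrite card_factor.
apply: (@le_trans _ _ (\sum_(t : 'I_J * 'I_d.+1 * {ffun 'I_d -> 'I_(2 ^ J)})
   (2 * 'C(M ^ d, n ^ d)%:R * expR (- (K / 6))))); last first.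
  rewrite sumr_const !card_prod card_ffun !card_ord -[leLHS]mulr_natl.
  by rewrite le_eqVlt; apply/orP; left; apply/eqP; ring.
rewrite -[leLHS]/((_)%:R).
apply: le_trans (_ : (\sum_t _)%N%:R <= _).
  by rewrite ler_nat; apply: card_exists_le.
rewrite natr_sum; apply: ler_sum => -[[j r] p] _ /=.
set a := (2 ^ (J - j.+1))%N; set b := @dyadic_sides d J j r; set V := (\prod_i b i)%N.
have a0 : (0 < a)%N by rewrite expn_gt0.
have b0 i : (0 < b i)%N by rewrite /b /dyadic_sides; case: ifP; rewrite expn_gt0.
have bs i : (b i %| 2 ^ J)%N by rewrite /b /dyadic_sides; case: ifP => _; rewrite dvdn_exp2l ?leq_subr.
have ab i : (a <= b i)%N.
  by rewrite /b /dyadic_sides; case: ifP => // _; rewrite leq_exp2l // leq_sub2l.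
have V0 : (0 < V)%N by rewrite prodn_gt0.
have aV : (a ^ 2 <= V)%N.
  apply: (@leq_trans (a ^ d)); first by rewrite leq_pexp2l.
  by rewrite /V -{1}(card_ord d) -prod_nat_const leq_prod.
have L0 : 0 < L by rewrite divr_gt0 ?ltr0n ?expn_gt0 ?n0.
have cT : #|box d M| = (M ^ d)%N by rewrite card_ffun !card_ord.
have M0 : (0 < M)%N by apply: leq_trans nM.
have aR : 0 < a%:R :> R by rewrite ltr0n.
have VR : 0 < V%:R :> R by rewrite ltr0n.
have aL : 0 < a%:R * L := mulr_gt0 aR L0.
pose delta : R := tau / (a%:R * L).
have delta0 : 0 < delta by exact: divr_gt0.
have delta1 : delta <= 1.
  rewrite /delta ler_pdivrMr // mul1r; apply: (le_trans tauL).
  by rewrite ler_peMl ?ler1n // ltW.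
have EE : (n ^ d)%:R * #|block hm b p|%:R / #|box d M|%:R = L * V%:R :> R.
  rewrite card_block // cT hm expnMn /L -/V !natrM !natrX; field.
  by rewrite !expf_neq0 // pnatr_eq0 -lt0n // expn_gt0.
have := @hypergeometric_tail R (box d M) (n ^ d) delta (block hm b p) delta0 delta1.
have nMd : (n ^ d <= M ^ d)%N by rewrite leq_exp2r // (leq_trans _ d2).
have Md0 : (0 < M ^ d)%N by rewrite expn_gt0 M0.
rewrite EE cT => /(_ nMd Md0) h; apply: le_trans (le_trans h _).
  rewrite ler_nat -(card_imset _ val_inj); apply: subset_leq_card; apply/fintype.subsetP=> S.
  case/imsetP=> w; rewrite !inE => hw ->; rewrite (valP w) /=.
  move: hw; set X := #|_|%:R => hw.
  have -> : delta * (L * V%:R) = tau / a%:R * V%:R.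
    by rewrite /delta; field; rewrite !gt_eqF.
  have -> : X - L * V%:R = (X / V%:R - L) * V%:R by field; rewrite gt_eqF.
  by rewrite normrM (gtr0_norm VR) ltr_pM2r.
rewrite ler_wpM2l ?mulr_ge0 ?ler0n // ler_expR lerN2.
rewrite ler_pM2r ?invr_gt0 ?ltr0n //.
have K0 : 0 <= K by rewrite -(pmulr_lge0 _ L0) -tau2 sqr_ge0.
have -> : L * V%:R * delta ^+ 2 = K * (V%:R / a%:R ^+ 2).
  rewrite /delta expr_div_n tau2; field; rewrite !gt_eqF //.
by rewrite ler_peMr // ler_pdivlMr ?exprn_gt0 // mul1r -natrX ler_nat.
Qed.

(** As [n <= M], rescaling by [n / M] does not expand; each of two points errs by at most
    [3 * k * n / M = 3 * n / 2 ^ J], hence the [6]. *)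
Lemma Fn_good_sample (R : realType) (d M n k J : nat) (hm : M = (2 ^ J * k)%N) (tau : R)
    (S : Defs.factor d M (n ^ d)%N) :
  let L := (n ^ d)%:R / ((2 ^ J) ^ d)%:R in
  (0 < k)%N -> (2 ^ J <= n)%N -> (n <= M)%N ->
  (J * d)%:R * (8 * tau) <= L / 2 -> tau <= L / 2 ->
  S \notin bad_samples d n hm tau ->
  Fn R n ((@embed d M) @` [set p | p \in val S])%classic <= d%:R * (1 + 6 * (n%:R / (2 ^ J)%:R)).
Proof.
move=> L k0 sn nM h1 h2 Sb.
have s0 : (0 < 2 ^ J)%N by rewrite expn_gt0.
have n0 : (0 < n)%N by apply: leq_trans sn.
have M0 : (0 < M)%N by apply: leq_trans nM.
have MR : 0 < M%:R :> R by rewrite ltr0n.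
have cS : #|val S| = (n ^ d)%N by apply/eqP/(valP S).
have [|f [fI fD]] := @spread_matching R d M n k J hm (val S) tau k0 sn cS _ h1 h2.
  move=> j r p jJ rd; rewrite leNgt; apply: contra Sb => hlt.
  by rewrite inE; apply/existsP; exists (Ordinal jJ, Ordinal (rd : (r < d.+1)%N), p).
apply: (Fn_le (f := f)) => //.
move=> p q i pS qS.
have [] := fD p pS i; have [] := fD q qS i.
rewrite -!(ler_nat R) !(natrD, natrM) => a1 a2 a3 a4.
set x := (p i)%:R in a3 a4 *; set x' := (q i)%:R in a1 a2 *.
set y := (f p i)%:R in a3 a4 *; set y' := (f q i)%:R in a1 a2 *.
have kn : k%:R * n%:R = n%:R / (2 ^ J)%:R * M%:R :> R.
  by rewrite hm natrM; field; rewrite pnatr_eq0 -lt0n.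
rewrite kn in a1 a2 a3 a4; set l := n%:R / _ in a1 a2 a3 a4 *.
have nMR : n%:R <= M%:R :> R by rewrite ler_nat.
have n0R : 0 <= n%:R :> R by [].
rewrite -(ler_pM2r MR) -{1}(gtr0_norm MR) -normrM mulrDl.
have hx : `|(x - x') * n%:R| <= `|x - x'| * M%:R by rewrite normrM (ger0_norm n0R) ler_wpM2l.
rewrite [leRHS]mulrDl; apply: le_trans (lerD hx (lexx _)).
have := ler_norm ((x - x') * n%:R); have := ler_norm (- ((x - x') * n%:R)); rewrite normrN.
by move=> u1 u2; rewrite ler_norml; lra.
Qed.

Local Open Scope classical_set_scope.

(** * Almost sure bounds *)

Lemma tail_inv_sq (R : realFieldType) (n0 N : nat) : (1 < n0)%N ->
  \sum_(i < N) ((n0 + i)%:R ^+ 2)^-1 <= (n0.-1%:R)^-1 :> R.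
Proof.
case: n0 => // n n1 /=.
suff : \sum_(i < N) ((n.+1 + i)%:R ^+ 2)^-1 <= n%:R^-1 - (n + N)%:R^-1 :> R.
  by move=> h; apply: le_trans h _; rewrite lerBlDr lerDl invr_ge0.
elim: N => [|N IH]; first by rewrite big_ord0 addn0 subrr.
rewrite big_ord_recr /=; apply: le_trans (lerD IH (lexx _)) _.
rewrite addnS addSn -natr1; set x : R := (n + N)%:R.
have x0 : 0 < x by rewrite ltr0n addn_gt0 -ltnS n1.
suff : ((x + 1) ^+ 2)^-1 <= x^-1 - (x + 1)^-1 by lra.
have -> : x^-1 - (x + 1)^-1 = (x * (x + 1))^-1 by field; lra.
rewrite lef_pV2 ?posrE ?exprn_gt0 ?mulr_gt0 //; nra.
Qed.

(** Outside [E], for every [n0 >= N0] some [w n] with [n >= n0] is bad. These events are cylinders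
    restricting one coordinate, of total measure at most [C / (n0 - 1)]. *)
Lemma borel_cantelli (R : realType) d m (bad : forall n, {set Defs.factor d (m n) (n ^ d)%N})
    (C : R) (N0 : nat) (E : set (Omega d m)) :
  0 <= C ->
  (forall n, (N0 <= n)%N ->
     #|bad n|%:R <= C / n%:R ^+ 2 * #|[set: Defs.factor d (m n) (n ^ d)%N]%SET|%:R) ->
  (forall w n0, (N0 <= n0)%N -> (forall n, (n0 <= n)%N -> w n \notin bad n) -> E w) ->
  almost_surely R E.
Proof.
move=> C0 hbad hE eps eps0.
pose n0 := (maxn N0 (Num.truncn (C / eps)).+2).
have n01 : (1 < n0)%N by rewrite /n0; lia.
have n0N : (N0 <= n0)%N by rewrite leq_maxl.
have Ceps : C / n0.-1%:R <= eps.
  have p0 : 0 < n0.-1%:R :> R by rewrite ltr0n; lia.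
  rewrite ler_pdivrMr // mulrC -ler_pdivrMr //; apply: ltW.
  by apply: lt_le_trans (truncnS_gt _) _; rewrite ler_nat -ltnS (prednK (ltnW n01)) leq_maxr.
pose A n j : {set Defs.factor d (m j) (j ^ d)%N} := if j == n then bad j else [set: _]%SET.
exists (fun i => Cyl (n0 + i).+1 (A (n0 + i)%N)); split.
  move=> w nE; have [i wi] : exists i, w (n0 + i)%N \in bad (n0 + i)%N.
    apply: contrapT => no; apply: nE; apply: (hE w n0) => // n n0n.
    by apply/negP => wn; apply: no; exists (n - n0)%N; rewrite subnKC.
  by exists i => // j /= _; rewrite /A; case: eqP => [->|] //; rewrite inE.
move=> N; apply: le_trans Ceps.
apply: le_trans (_ : \sum_(i < N) C / (n0 + i)%:R ^+ 2 <= _); last first.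
  by rewrite -mulr_sumr ler_wpM2l // tail_inv_sq.
apply: ler_sum => i _; rewrite /cyl_mu big_ord_recr /=.
set n := (n0 + i)%N.
have cE j : #|[set: Defs.factor d (m j) (j ^ d)%N]| = #|[set: Defs.factor d (m j) (j ^ d)%N]%SET|.
  by apply: eq_card => x; rewrite finset.in_setT [LHS]in_setT. 
apply: le_trans (_ : #|bad n|%:R / #|[set: Defs.factor d (m n) (n ^ d)%N]%SET|%:R <= _).
  rewrite cE {2}/A eqxx -[leRHS]mul1r ler_wpM2r ?divr_ge0 //.
  apply: prodr_ile1 => j _; rewrite cE divr_ge0 //=.
  (* An empty factor gives the quotient [0], so unrestricted coordinates contribute at most [1]. *)
  set c := #|[set: _]%SET|; have [c0|c0] := posnP c; first by rewrite c0 invr0 mulr0.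
  by rewrite ler_pdivrMr ?ltr0n // mul1r ler_nat subset_leq_card // finset.subsetT.
set c := #|[set: _]%SET|; have [c0|c0] := posnP c.
  by rewrite c0 invr0 mulr0 divr_ge0 // exprn_ge0.
by rewrite ler_pdivrMr ?ltr0n //; apply: hbad; rewrite (leq_trans n0N) ?leq_addr.
Qed.

Lemma limn_esup_lty (R : realType) (u : nat -> \bar R) (K : R) n0 :
  (forall n, (n0 <= n)%N -> (u n <= K%:E)%E) -> (limn_esup u < +oo)%E.
Proof.
move=> uK; rewrite limn_esup_lim (cvg_lim _ (@cvg_esups_inf _ u)) //.
apply: (@le_lt_trans _ _ (esups u n0)); first by apply: ereal_inf_lbound; exists n0.
apply: (@le_lt_trans _ _ K%:E); last exact: ltry.
by apply: ge_ereal_sup => _ [n /= n0n <-]; apply: uK.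
Qed.

Lemma ln_cube_le (R : realType) (C : R) : 0 <= C ->
  exists N : nat, forall n, (N <= n)%N -> C * ln n%:R ^+ 3 <= n%:R.
Proof.
(* Here [256 = 4 ^ 4]: with [x = ln n >= 256 * C], [n = expR (x / 4) ^ 4 >= (x / 4) ^ 4 = x / 256 *
   x ^ 3]. *)
move=> C0; exists (Num.truncn (expR (256 * C))).+1 => n Nn.
have nx : expR (256 * C) <= n%:R.
  by apply: ltW; apply: lt_le_trans (truncnS_gt _) _; rewrite ler_nat.
have n0 : 0 < n%:R :> R by apply: lt_le_trans (expR_gt0 _) nx.
set x := ln n%:R.
have xC : 256 * C <= x by rewrite -ler_expR lnK.
have x0 : 0 <= x by apply: le_trans xC; rewrite mulr_ge0 ?ler0n.
have -> : n%:R = expR (4%:R * (x / 4)) :> R by rewrite -[LHS]lnK // -/x; congr expR; field.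
rewrite expRM_natl.
have : (x / 4) ^+ 4 <= expR (x / 4) ^+ 4.
  rewrite lerXn2r ?nnegrE ?expR_ge0 ?divr_ge0 //.
  by apply: le_trans (expR_ge1Dx _); lra.
apply: le_trans; have -> : (x / 4) ^+ 4 = x / 256 * x ^+ 3 by field.
by rewrite ler_wpM2r ?exprn_ge0 //; lra.
Qed.

(** * Choice of the scale *)

Lemma ln2_bounds (R : realType) : 0 < ln 2 :> R /\ ln 2 <= 1 :> R.
Proof.
split; first by rewrite ln_gt0 // ltr1n.
by have := @le_ln1Dx R 1; rewrite (_ : 1 + 1 = 2 :> R) // => -> //; lra.
Qed.

Lemma log2_ge1 (R : realType) n : (2 <= n)%N -> 1 <= Defs.log2 n%:R :> R.
Proof.
move=> n2; have [l0 _] := ln2_bounds R.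
by rewrite /Defs.log2 ler_pdivlMr // mul1r ler_ln ?posrE ?ltr0n ?ler_nat // (leq_trans _ n2).
Qed.

Lemma ln_le_log2 (R : realType) n : (0 < n)%N -> ln n%:R <= Defs.log2 n%:R :> R.
Proof.
move=> n0; have [l0 l1] := ln2_bounds R.
by rewrite /Defs.log2 ler_pdivlMr // ler_piMr // ln_ge0 // ler1n.
Qed.

Lemma log2_ge_exp (R : realType) J n : (2 ^ J <= n)%N -> J%:R <= Defs.log2 n%:R :> R.
Proof.
move=> Jn; have [l0 _] := ln2_bounds R.
rewrite /Defs.log2 ler_pdivlMr // mulr_natl -lnXn // -natrX.
by rewrite ler_ln ?posrE ?ltr0n ?ler_nat ?expn_gt0 // (leq_trans _ Jn) // expn_gt0.
Qed.

Lemma log2_le (R : realType) n : (0 < n)%N -> Defs.log2 n%:R <= n%:R :> R.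
Proof.
move=> n0; have [l0 _] := ln2_bounds R.
rewrite /Defs.log2 ler_pdivrMr // mulr_natl -lnXn // -natrX.
by rewrite ler_ln ?posrE ?ltr0n ?ler_nat ?expn_gt0 // ltnW // ltn_expl.
Qed.

(* The prescribed number of points per cell, up to a factor [2 ^ d]; [2 ^+ 11] is what makes the flow
   of [dyadic_flow] cheaper than half of a cell for [tau ^+ 2 = 6 * (d + 3) * ln n * L]. *)
Definition cell_size (R : realType) (d n : nat) : R :=
  2 ^+ 11 * (d + 3)%:R * d%:R ^+ 2 * Defs.log2 n%:R ^+ 3.

Definition radius (R : realType) (d n : nat) : nat :=
  (Num.truncn (cell_size R d n `^ d%:R^-1)).+1.

(** The largest exponent for which target cells keep side at least [radius]; it is [0] when [radius]
    exceeds [n]. *)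
Definition depth (R : realType) (d n : nat) : nat := trunc_log 2 (n %/ radius R d n).

Lemma cell_size_ge (R : realType) d n : (2 <= d)%N -> (2 <= n)%N ->
  Defs.log2 n%:R <= cell_size R d n /\ 1 <= cell_size R d n.
Proof.
move=> d2 n2; have l1 := log2_ge1 R n2.
suff h : Defs.log2 n%:R <= cell_size R d n by split=> //; apply: le_trans l1 h.
rewrite /cell_size; set l := Defs.log2 _ in l1 *; set c := 2 ^+ 11 * _ * _.
have c1 : 1 <= c.
  by rewrite /c !mulr_ege1 ?exprn_ege1 ?ler1n // ?addn_gt0 ?orbT // ltnW.
have : l <= l ^+ 3 by rewrite exprS ler_peMr ?exprn_ege1 // (le_trans ler01).
have : 0 <= l ^+ 3 by rewrite exprn_ge0 // (le_trans ler01).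
nra.
Qed.

Lemma root_powR (R : realType) d (x : R) : (0 < d)%N -> 0 <= x -> (x `^ d%:R^-1) ^+ d = x.
Proof.
move=> d0 x0; rewrite -powR_mulrn ?powR_ge0 // -powRrM mulVf ?powRr1 //.
by rewrite pnatr_eq0 -lt0n.
Qed.

Lemma powR_root_ge1 (R : realType) d (x : R) : 1 <= x -> 1 <= x `^ d%:R^-1.
Proof. by move=> x1; rewrite -[leLHS](powRr0 x) ler_powR // invr_ge0. Qed.

Lemma powR_root_le (R : realType) d (x : R) : (0 < d)%N -> 1 <= x -> x `^ d%:R^-1 <= x.
Proof.
move=> d0 x1; rewrite -[leRHS](powRr1 (le_trans ler01 x1)) ler_powR //.
by rewrite invf_le1 ?ltr0n // ler1n.
Qed.

Lemma radius_bounds (R : realType) d n :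
  let y := cell_size R d n `^ d%:R^-1 in y <= (radius R d n)%:R /\ (radius R d n)%:R <= y + 1.
Proof.
move=> y; have y0 : 0 <= y by apply: powR_ge0.
split; first by apply: ltW; apply: truncnS_gt.
by rewrite -natr1 lerD2r truncn_le.
Qed.

Lemma depth_bounds (R : realType) d n (r := radius R d n) (s := (2 ^ depth R d n)%N) :
  (0 < n)%N -> [/\ (s <= n)%N, (n < r * (2 * s))%N & (r <= n)%N -> (s * r <= n)%N].
Proof.
move=> n0; have r0 : (0 < r)%N by [].
have h : (r <= n)%N -> (s * r <= n)%N.
  by move=> rn; rewrite -leq_divRL // /s /depth trunc_logP // divn_gt0.
split=> //.
  have [rn|rn] := leqP r n; first by apply: leq_trans (h rn); rewrite leq_pmulr.
  by rewrite /s /depth divn_small // trunc_log0.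
by rewrite mulnC -ltn_divLR // /s -expnS trunc_log_ltn.
Qed.

(** This quotient will bound [|c n - e n|]. It is at most [1 / radius], and [radius] is at least the
    root of [cell_size >= log2 n]; if [radius > n], a single cell remains and [log2 n <= n]
    suffices. *)
Lemma scale_root_log (R : realType) d n : (2 <= d)%N -> (2 <= n)%N ->
  (2 ^ depth R d n)%:R / n%:R <= (Defs.log2 n%:R `^ d%:R^-1)^-1 :> R.
Proof.
move=> d2 n2; have n0 : (0 < n)%N by apply: ltnW.
have d0 : (0 < d)%N by apply: ltnW.
have [_ _ sr] := depth_bounds R d n0.
have l1 := log2_ge1 R n2; have l0 : 0 < Defs.log2 n%:R :> R by apply: lt_le_trans l1.
have nR : 0 < n%:R :> R by rewrite ltr0n.
rewrite ler_pdivrMr // mulrC ler_pdivlMr ?powR_gt0 //.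
have [rn|rn] := leqP (radius R d n) n.
  apply: (@le_trans _ _ ((2 ^ depth R d n)%:R * (radius R d n)%:R)).
    rewrite ler_wpM2l //; have [+ _] := radius_bounds R d n; apply: le_trans.
    have [h1 h2] := cell_size_ge R d2 n2.
    by apply: ge0_ler_powR; rewrite ?nnegrE ?invr_ge0 ?(ltW l0) // (le_trans ler01).
  by rewrite -natrM ler_nat sr.
rewrite /depth divn_small // trunc_log0 expn0 mul1r.
exact: le_trans (powR_root_le d0 l1) (log2_le R n0).
Qed.

Lemma radius_le (R : realType) d : (2 <= d)%N ->
  exists N, forall n, (N <= n)%N -> (radius R d n <= n)%N.
Proof.
move=> d2; have [l0 _] := ln2_bounds R; have d0 : (0 < d)%N by apply: ltnW.
have [|N hN] := @ln_cube_le R (2 * (2 ^+ 11 * (d + 3)%:R * d%:R ^+ 2) / ln 2 ^+ 3).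
  by rewrite divr_ge0 ?mulr_ge0 ?exprn_ge0 ?(ltW l0).
exists (maxn N 2) => n; rewrite geq_max => /andP[/hN h n2].
have [_ c1] := cell_size_ge R d2 n2.
rewrite -(ler_nat R); have [_ rb] := radius_bounds R d n.
apply: (le_trans rb); apply: le_trans h.
rewrite (_ : _ / _ * _ = 2 * cell_size R d n); last first.
  by rewrite /cell_size /Defs.log2; field; rewrite gt_eqF.
have := powR_root_le d0 c1; lra.
Qed.

(** * Size of the deviation, failure probability and growth rate *)

Lemma mulr_sqrt_le (R : realType) (a K L : R) : 0 <= a -> 0 <= L ->
  a ^+ 2 * K <= L -> a * Num.sqrt (K * L) <= L.
Proof.
move=> a0 L0 h; rewrite -{1}(ger0_norm a0) -sqrtr_sqr -sqrtrM ?sqr_ge0 //.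
rewrite -{2}(ger0_norm L0) -sqrtr_sqr; apply: ler_wsqrtr.
by rewrite mulrA [leRHS]expr2 ler_wpM2r.
Qed.

(** Chosen so that the Chernoff bound lets each block fail with probability at most
    [2 / n ^ (d + 3)]. *)
Definition deviation (R : realType) (d n : nat) : R :=
  Num.sqrt (6 * (d + 3)%:R * ln n%:R * ((n ^ d)%:R / ((2 ^ depth R d n) ^ d)%:R)).

(** The cube of the logarithm arises here: after squaring, the number of steps contributes
    [J ^ 2 <= log2 n ^ 2], and [ln n] in the deviation contributes one more logarithm. *)
Lemma deviation_small (R : realType) d n (J := depth R d n)
    (L : R := (n ^ d)%:R / ((2 ^ J) ^ d)%:R) :
  (2 <= d)%N -> (2 <= n)%N -> (radius R d n <= n)%N ->
  [/\ 0 < deviation R d n, deviation R d n <= L / 2,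
      (J * d)%:R * (8 * deviation R d n) <= L / 2 &
      deviation R d n ^+ 2 = 6 * (d + 3)%:R * ln n%:R * L].
Proof.
move=> d2 n2 rn; have n0 : (0 < n)%N by apply: ltnW.
have d0 : (0 < d)%N by apply: ltnW.
have s0 : (0 < 2 ^ J)%N by rewrite expn_gt0.
have [sn _ /(_ rn) sr] := depth_bounds R d n0.
have L0 : 0 < L by rewrite divr_gt0 // ltr0n expn_gt0 ?n0 ?s0.
have cL : cell_size R d n <= L.
  have [c1 c2] := cell_size_ge R d2 n2.
  rewrite -(root_powR d0 (le_trans ler01 c2)) /L !(natrX _ _ d) -expr_div_n.
  rewrite lerXn2r ?nnegrE ?powR_ge0 ?divr_ge0 //.
  have [+ _] := radius_bounds R d n => /le_trans; apply.
  by rewrite ler_pdivlMr ?ltr0n // -natrM ler_nat mulnC.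
rewrite /deviation -/J -/L.
have l1 := log2_ge1 R n2; have lnl := ln_le_log2 R n0; have Jl := log2_ge_exp R sn.
have ln0 : 0 < ln n%:R :> R by rewrite ln_gt0 // ltr1n.
rewrite /cell_size in cL.
set D := (d + 3)%:R in cL *; have D0 : 0 < D by rewrite /D ltr0n addn_gt0 orbT.
set K := 6 * _ * _; set l := Defs.log2 _ in l1 lnl Jl cL.
have K0 : 0 < K by rewrite /K !mulr_gt0.
have dR : 1 <= d%:R :> R by rewrite ler1n.
have dd : 1 <= d%:R ^+ 2 :> R by rewrite exprn_ege1.
have Kl : K <= 6 * D * l by rewrite /K ler_wpM2l // mulr_ge0 // ltW.
have l20 : 1 <= l ^+ 2 by rewrite exprn_ege1.
have cE : 2 ^+ 11 * D * d%:R ^+ 2 * l ^+ 3 = 2 ^+ 11 * (d%:R ^+ 2 * l ^+ 2) * (D * l) by ring.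
rewrite cE in cL.
have Dl0 : 0 < D * l by rewrite mulr_gt0 // (lt_le_trans ltr01).
split.
- by rewrite sqrtr_gt0 mulr_gt0.
- have : 2 * Num.sqrt (K * L) <= L.
    apply: mulr_sqrt_le; rewrite ?(ltW L0) //.
    apply: le_trans cL; have : 1 <= d%:R ^+ 2 * l ^+ 2 by rewrite mulr_ege1.
    nra.
  lra.
(* The squared inequality holds because [16 ^ 2 * 6 = 1536 <= 2 ^ 11]. *)
- have : (16 * (J%:R * d%:R)) * Num.sqrt (K * L) <= L.
    apply: mulr_sqrt_le; rewrite ?(ltW L0) ?mulr_ge0 //.
    apply: le_trans cL.
    have JJ : J%:R ^+ 2 <= l ^+ 2 by rewrite lerXn2r ?nnegrE // (le_trans ler01).
    have : d%:R ^+ 2 * J%:R ^+ 2 <= d%:R ^+ 2 * l ^+ 2 by rewrite ler_wpM2l // exprn_ge0.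
    set u := _ * J%:R ^+ 2; set v := _ * l ^+ 2 => uv.
    have u0 : 0 <= u by rewrite mulr_ge0 ?exprn_ge0.
    have -> : (16 * (J%:R * d%:R)) ^+ 2 * K = 256 * (u * K) by rewrite /u; ring.
    have h1 : u * K <= v * (6 * D * l) by rewrite ler_pM // ltW.
    have h2 : 0 <= v * (D * l) by rewrite mulr_ge0 ?(ltW Dl0) ?(le_trans u0).
    have : u * K <= 6 * (v * (D * l)) by apply: le_trans h1 _; rewrite le_eqVlt; apply/orP; left; apply/eqP; ring.
    rewrite -mulrA; lra.
  rewrite natrM; lra.
- by rewrite sqr_sqrtr // mulr_ge0 ?ltW.
Qed.

(** At most [n * (d + 1) * n ^ d] pairs of stage and block occur, which leaves a summable
    [n ^ -2]. *)
Lemma bad_prob (R : realType) d n k M (hm : M = (2 ^ depth R d n * k)%N) :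
  (2 <= d)%N -> (2 <= n)%N -> (radius R d n <= n)%N -> (0 < k)%N -> (n <= M)%N ->
  #|bad_samples d n hm (deviation R d n)|%:R <=
    2 * d.+1%:R / n%:R ^+ 2 * #|[set: Defs.factor d M (n ^ d)%N]%SET|%:R :> R.
Proof.
move=> d2 n2 rn k0 nM; have n0 : (0 < n)%N by apply: ltnW.
have [t0 t1 _ t2] := deviation_small d2 n2 rn.
have [sn _ _] := depth_bounds R d n0.
have nR : 0 < n%:R :> R by rewrite ltr0n.
apply: le_trans (card_bad hm d2 n0 k0 nM t0 _ t2) _; first by lra.
rewrite ler_wpM2r //.
have -> : 6 * (d + 3)%:R * ln n%:R / 6 = (d + 3)%:R * ln n%:R :> R by field.
rewrite expRN expRM_natl lnK ?posrE //.
have -> : 2 * d.+1%:R / n%:R ^+ 2 = (n * d.+1 * n ^ d)%:R * (2 * (n%:R ^+ (d + 3))^-1) :> R.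
  rewrite !natrM natrX exprD [n%:R ^+ 3]exprS; field.
  by rewrite expf_neq0 gt_eqF.
rewrite ler_wpM2r ?mulr_ge0 ?invr_ge0 ?exprn_ge0 // ler_nat.
rewrite leq_mul ?leq_mul2r ?leq_exp2r ?sn ?(ltnW d2) //.
by apply/orP; right; apply: leq_trans sn; rewrite ltnW // ltn_expl.
Qed.

(** With [y] the root of [cell_size], [n / 2 ^ J <= 2 * radius <= 4 * y] and
    [1 + 6 * (4 * y) <= 25 * y]. As [y] is a constant times [log2 n] to the power [3 / d], the
    exponent left is [(3 - alpha) / d <= 0]. *)
Lemma Fn_rescaled (R : realType) d n (alpha F : R) :
  (2 <= d)%N -> (2 <= n)%N -> 3 < alpha ->
  F <= d%:R * (1 + 6 * (n%:R / (2 ^ depth R d n)%:R)) ->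
  F * Defs.log2 n%:R `^ (- alpha / d%:R) <=
    25 * d%:R * (2 ^+ 11 * (d + 3)%:R * d%:R ^+ 2) `^ d%:R^-1.
Proof.
have arith1 (r y : R) : 1 <= y -> r <= y + 1 -> r * 2 <= 4 * y by lra.
have arith2 (q y : R) : 1 <= y -> q <= 4 * y -> 1 + 6 * q <= 25 * y by lra.
have a0 : 3 < alpha -> 3 - alpha <= 0 by lra.
move=> d2 n2 /a0 {}a0 hF; have n0 : (0 < n)%N by apply: ltnW.
have d0 : (0 < d)%N by apply: ltnW.
have l1 := log2_ge1 R n2; set l := Defs.log2 _ in l1 *.
have l0 : 0 < l by apply: lt_le_trans l1.
have [_ c1] := cell_size_ge R d2 n2.
have y1 := powR_root_ge1 d c1; have [_] := radius_bounds R d n.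
have [_ nrs _] := depth_bounds R d n0.
have yE : cell_size R d n `^ d%:R^-1 =
    (2 ^+ 11 * (d + 3)%:R * d%:R ^+ 2) `^ d%:R^-1 * l `^ (3 / d%:R).
  have b0 : 0 <= 2 ^+ 11 * (d + 3)%:R * d%:R ^+ 2 :> R by rewrite !mulr_ge0 ?exprn_ge0.
  rewrite /cell_size -/l (powRM _ b0 (exprn_ge0 3 (ltW l0))).
  by rewrite -(powR_mulrn 3 (ltW l0)) -powRrM.
set y := cell_size R d n `^ _ in y1 yE *; set c := _ `^ d%:R^-1 in yE * => ry.
have ns : n%:R / (2 ^ depth R d n)%:R <= 4 * y.
  rewrite ler_pdivrMr ?ltr0n ?expn_gt0 //.
  move: nrs; rewrite -(ltr_nat R) !natrM => /ltW /le_trans; apply.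
  by rewrite mulrA ler_wpM2r // arith1.
have Fy : F <= 25 * d%:R * y.
  apply: (le_trans hF); by rewrite [25 * _]mulrC -mulrA ler_wpM2l // arith2.
have p0 : 0 <= l `^ (- alpha / d%:R) by apply: powR_ge0.
apply: le_trans (ler_wpM2r p0 Fy) _.
rewrite yE -!mulrA ler_wpM2l // ler_wpM2l // -[leRHS]mulr1 ler_wpM2l ?powR_ge0 //.
rewrite -powRD; last by rewrite (gt_eqF l0) implybT.
rewrite -mulrDl -[leRHS](powRr0 l); apply: ler_powR => //.
by rewrite mulr_le0_ge0 ?invr_ge0.
Qed.

Unset Implicit Arguments.

Theorem theorem2 (R : realType) (d : nat) (hd : (2 <= d)%N)
  (e : nat -> R) (he : forall n, 1 <= e n) :
  exists c : nat -> R,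
    (forall n, 0 < c n) /\
    (forall n, n%:R <= c n * n%:R) /\
    (forall n, (2 <= n)%N ->
       `|c n - e n| <= 2 ^+ (d + 8) / (log2 n%:R) `^ (1 / d%:R)) /\
    (forall alpha : R, 3 < alpha ->
       almost_surely R
         (fun w : Omega d (fun n => Num.truncn (c n * n%:R)) => (limn_esup (fun n =>
             (@Fn R d n (rand_set w n) * (log2 n%:R) `^ (- alpha / d%:R))%:E)
           < +oo)%E)).
Proof.
have arith (a b u : R) : a <= b -> b <= a + u -> `|b - a| <= u.
  by move=> *; rewrite ler_norml; lra.
pose s n := (2 ^ depth R d n)%N.
(* [s n * k n] is the first multiple of [s n] beyond [e n * n], so [c n] exceeds [e n] by at most
   [s n / n]. *)
pose k n := (Num.truncn (e n * n%:R / (s n)%:R)).+1.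
pose c n : R := if n is 0%N then 1 else (s n * k n)%:R / n%:R.
have sR n : 0 < (s n)%:R :> R by rewrite ltr0n expn_gt0.
have cn n : (0 < n)%N -> c n * n%:R = (s n * k n)%:R.
  by case: n => // n _; rewrite /c divfK // pnatr_eq0.
have ken n : e n * n%:R <= (s n * k n)%:R.
  rewrite mulnC natrM -ler_pdivrMr //; apply: ltW; exact: truncnS_gt.
have kes n : (s n * k n)%:R <= e n * n%:R + (s n)%:R.
  rewrite -[k n]addn1 mulnDr muln1 natrD lerD2r mulnC natrM -ler_pdivlMr //.
  by rewrite truncn_le divr_ge0 // mulr_ge0 // (le_trans ler01).
have nc n : n%:R <= c n * n%:R.
  case: n => [|n]; first by rewrite mulr0.
  by rewrite cn //; apply: le_trans (ken _); rewrite ler_peMl.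
exists c; split; first by case=> [|n] //=; rewrite divr_gt0 ?ltr0n ?muln_gt0 ?expn_gt0.
split=> //; split.
  move=> n n2; have n0 : (0 < n)%N by apply: ltnW.
  have nR : 0 < n%:R :> R by rewrite ltr0n.
  have h := scale_root_log R hd n2.
  have ce : `|c n - e n| <= (s n)%:R / n%:R.
    rewrite ler_pdivlMr // -{1}(gtr0_norm nR) -normrM mulrBl cn //.
    exact: arith (ken n) (kes n).
  apply: (le_trans ce); apply: (le_trans h); rewrite mul1r ler_peMl ?invr_ge0 ?powR_ge0 //.
  by rewrite exprn_ege1 // ler1n.
move=> alpha a3.
pose M n := Num.truncn (c n * n%:R).
have ME n : (0 < n)%N -> M n = (s n * k n)%N by move=> n0; rewrite /M cn // natrK.
(* [bad_samples] depends on a proof of [M n = s n * k n], so that equation is decided first; it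
   fails only at [n = 0]. *)
pose B n : {set Defs.factor d (M n) (n ^ d)%N} :=
  if (M n =P (s n * k n)%N) is ReflectT hm then bad_samples d n hm (deviation R d n) else [set: _]%SET.
have [N hN] := radius_le R hd.
apply: (@borel_cantelli R d M B (2 * d.+1%:R) (maxn N 2)) => //.
  move=> n; rewrite geq_max => /andP[/hN rn n2]; have n0 : (0 < n)%N by apply: ltnW.
  rewrite /B; case: eqP => [hm|/(_ (ME n n0)) //].
  by apply: bad_prob => //; rewrite -(ler_nat R) hm -cn.
move=> w n0 Nn0 wB.
apply: (@limn_esup_lty _ _ _ n0) => n n0n.
have : (maxn N 2 <= n)%N by apply: leq_trans n0n.
rewrite geq_max => /andP[/hN rn n2]; have n1 : (0 < n)%N by apply: ltnW.
rewrite lee_fin; apply: Fn_rescaled => //.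
have [_ t1 t3 _] := deviation_small hd n2 rn.
have [sn _ _] := depth_bounds R d n1.
have := wB n n0n; rewrite /B; case: eqP => [hm|/(_ (ME n n1)) //] wn.
by apply: (Fn_good_sample (hm := hm)) wn => //; rewrite -(ler_nat R) hm -cn.
Qed.
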